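(* Let $T>0$, $d\ge 1$, $1\le p<\infty$ and $x_0\in R^d$. Let $\mathcal{R}\subset BV_p(R^d)$ be a set with $\mathcal{R}(0)=\{x_0\}$ which is bounded (in $BV_p(R^d)$), $V_p$-decomposable, convex, and closed with respect to the norm $\|\cdot\|_\infty$. Then $\mathcal{R}$ is an integral.
   Context: $R^d$ carries the Euclidean norm $\|\cdot\|$. For $f:[0,T]\to R^d$, $\|f\|_\infty=\sup_{t\in[0,T]}\|f(t)\|$, and the Riesz $p$-variation is $V_p(f)=\sup\sum_{i=1}^n \frac{\|f(t_i)-f(t_{i-1})\|^p}{(t_i-t_{i-1})^{p-1}}$, the supremum being over all partitions $0=t_0<t_1<\dots<t_n=T$. $BV_p(R^d)$ is the space of all $f:[0,T]\to R^d$ with $V_p(f)<\infty$, normed by $\|f\|_{V_p}=\|f\|_\infty+(V_p(f))^{1/p}$. For $\mathcal{R}\subset BV_p(R^d)$ put $\mathcal{R}(t)=\{f(t):f\in\mathcal{R}\}$. $Conv(R^d)$ is the family of nonempty compact convex subsets of $R^d$. A measurable set-valued function $\Phi$ on $[0,T]$ is $p$-integrably bounded if there is $g\in L^p([0,T])$ with $\sup_{a\in\Phi(t)}\|a\|\le g(t)$ for a.e. $t$. $S_{L^p}(\Phi)=\{\phi\in L^p([0,T],R^d):\phi(t)\in\Phi(t)\text{ for a.e. }t\in[0,T]\}$. A set $\mathcal{R}\subset BV_p(R^d)$ is called an integral if there exist $x_0\in R^d$ and a measurable and $p$-integrably bounded set-valued function $\Phi:[0,T]\to Conv(R^d)$ such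 that $\mathcal{R}=\{f\in BV_p(R^d): f(\cdot)=x_0+\int_0^{\cdot}\phi(s)\,ds,\ \phi\in S_{L^p}(\Phi)\}$. A set $\Lambda\subset BV_p(R^d)$ is $V_p$-decomposable if for every $f_1,f_2\in\Lambda$ and every $a\in[0,T]$ the function $f_1\oplus_a f_2$ defined by $(f_1\oplus_a f_2)(t)=f_1(0)+\int_0^t\big(\mathbf{1}_{[0,a)}(s)f_1'(s)+\mathbf{1}_{[a,T]}(s)f_2'(s)\big)ds$, $t\in[0,T]$, belongs to $\Lambda$ (here $f_i'$ is the a.e. derivative of $f_i$).
   Formalization: For p = 1 it is additionally assumed that every function in R is absolutely continuous; without this the claim fails at p = 1, e.g. for R = {λ·1_[T/2,T] : 0 ≤ λ ≤ 1}, and the condition is necessary for R to be an integral. *)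

(* Defs.v *)
(* MathComp-Analysis.
   A function [0, T] -> R^d is represented by the function R -> 'rV[R]_d that
   extends it by 0 outside [0, T]; in this way equality of functions and of
   sets of functions is the one on [0, T].  Set-valued functions and members of
   L^p are arbitrary outside [0, T], where their values are never used. *)
From HB Require Import structures.
From mathcomp Require Import all_boot all_order all_algebra.
From mathcomp Require Import all_classical all_reals all_analysis.

Set Implicit Arguments.
Unset Strict Implicit.
Unset Printing Implicit Defensive.

Import Order.TTheory GRing.Theory Num.Theory.
Import numFieldNormedType.Exports.

Local Open Scope classical_set_scope.
Local Open Scope ring_scope.

Section defs.
Context {R : realType} {d : nat}.
Local Notation mu := (@lebesgue_measure R).
Implicit Types (T p a t : R) (f g phi : R -> 'rV[R]_d)
  (L : set (R -> 'rV[R]_d)) (Phi : R -> set 'rV[R]_d).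

(* The library norm `|x| on 'rV[R]_d is the max norm. *)
Definition enorm (x : 'rV[R]_d) : R := Num.sqrt (\sum_i x 0 i ^+ 2).

Definition supnorm T f : \bar R :=
  ereal_sup [set (enorm (f t))%:E | t in `[0, T]].

(* As in [itv_partition], s lists t_1, ..., t_n and the origin is left out. *)
Definition riesz_sum p f (s : seq R) : R :=
  \sum_(0 <= i < size s)
    enorm (f (nth 0 (0 :: s) i.+1) - f (nth 0 (0 :: s) i)) `^ p
      / (nth 0 (0 :: s) i.+1 - nth 0 (0 :: s) i) `^ (p - 1).

Definition riesz_variation T p f : \bar R :=
  ereal_sup [set (riesz_sum p f s)%:E | s in itv_partition 0 T].

Definition BVp T p : set (R -> 'rV[R]_d) :=
  [set f | (forall t, ~ `[0, T]%classic t -> f t = 0) /\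
           (riesz_variation T p f < +oo)%E].

Definition BVp_norm T p f : \bar R :=
  (supnorm T f + riesz_variation T p f `^ p^-1)%E.

Definition BVp_bounded T p L : Prop :=
  exists M : R, forall f, L f -> (BVp_norm T p f <= M%:E)%E.

(* Closed in BV_p for the metric of the sup norm. *)
Definition supnorm_closed T p L : Prop :=
  forall f, BVp T p f ->
    (forall e : R, 0 < e -> exists2 g, L g & (supnorm T (f \- g)%R < e%:E)%E) ->
    L f.

Definition abs_continuous T f : Prop :=
  forall e : R, 0 < e -> exists2 delta : R, 0 < delta &
    forall (n : nat) (u v : 'I_n -> R),
      (forall i, 0 <= u i /\ u i <= v i /\ v i <= T) ->
      (forall i j, i != j -> v i <= u j \/ v j <= u i) ->
      \sum_i (v i - u i) < delta ->
      \sum_i enorm (f (v i) - f (u i)) < e.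

Definition vintegral (phi : R -> 'rV[R]_d) t : 'rV[R]_d :=
  \row_i (\int[mu]_(s in `[0, t]) (phi s 0 i)).

(* [derive1] is total; its values at the points of non-differentiability, a
   null set for f in BV_p, are irrelevant. *)
Definition oplus T a f g : R -> 'rV[R]_d := fun t =>
  if 0 <= t <= T then
    f 0 + vintegral (fun s => \1_(`[0, a[) s *: derive1 f s
                              + \1_(`[a, T]) s *: derive1 g s) t
  else 0.

Definition Vp_decomposable T L : Prop :=
  forall f g a, L f -> L g -> 0 <= a <= T -> L (oplus T a f g).

Definition Lp_scalar T p (h : R -> R) : Prop :=
  measurable_fun `[0, T] h /\
  (\int[mu]_(s in `[0%R, T]) (`|h s| `^ p)%:E < +oo)%E.

(* Borel representatives suffice for L^p classes. *)
Definition Lp T p phi : Prop :=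
  (forall i, measurable_fun `[0, T] (fun s => phi s 0 i)) /\
  (\int[mu]_(s in `[0%R, T]) (enorm (phi s) `^ p)%:E < +oo)%E.

Definition Conv (K : set 'rV[R]_d) : Prop :=
  [/\ K !=set0, compact K & convex_set K].

Definition measurable_multifun T Phi : Prop :=
  forall C : set 'rV[R]_d, closed C ->
    measurable [set t : R | `[0, T]%classic t /\ Phi t `&` C !=set0].

Definition p_integrably_bounded T p Phi : Prop :=
  exists2 g : R -> R, Lp_scalar T p g &
    {ae mu, forall t, `[0, T]%classic t ->
      (ereal_sup [set (enorm x)%:E | x in Phi t] <= (g t)%:E)%E}.

Definition Lp_selections T p Phi : set (R -> 'rV[R]_d) :=
  [set phi | Lp T p phi /\ {ae mu, forall t, `[0, T]%classic t -> Phi t (phi t)}].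

Definition is_integral T p L : Prop :=
  exists (x0 : 'rV[R]_d) (Phi : R -> set 'rV[R]_d),
    [/\ forall t, `[0, T]%classic t -> Conv (Phi t),
        measurable_multifun T Phi,
        p_integrably_bounded T p Phi &
        L = [set f | BVp T p f /\
              exists2 phi, Lp_selections T p Phi phi &
                forall t, `[0, T]%classic t -> f t = x0 + vintegral phi t]].

End defs.

(* Main.v *)
Require Import Defs.
From HB Require Import structures.
From mathcomp Require Import all_boot all_order all_algebra.
From mathcomp Require Import all_classical all_reals all_analysis.
From mathcomp Require Import measurable_realfun ring lra.

Set Implicit Arguments.
Unset Strict Implicit.
Unset Printing Implicit Defensive.

Import Order.TTheory GRing.Theory Num.Theory.
Import numFieldNormedType.Exports.

Local Open Scope classical_set_scope.
Local Open Scope ring_scope.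

(** Each f in L is the primitive of an L^p density. For p = 1 this is absolute
    continuity; for p > 1 the bound on the Riesz sums makes the dyadic difference
    quotients uniformly integrable. These quotients form a martingale, so the integral
    of sqrt(1 + x^2) along them increases to a limit; its increments are integrals of
    the Bregman divergence of sqrt(1 + x^2), which controls the L^1 distance, and the
    quotients converge in L^1.

    Let D be the set of densities of elements of L. It is bounded in L^p, convex, closed
    under dominated convergence, and stable under gluing two densities along an
    interval [0, a[, hence along any Borel set. For a rational vector q, take a sequence
    in D minimizing the integral of min(1, |phi - q|). By gluing, almost everywhere its
    closest value to q is as close as the value of any given member of D. The
    countable union g over all q is therefore pointwise a.e. dense in D, and
    Phi(t) = closure of {g_n(t)} is the required multifunction: its convexity and
    p-integrable bound come from those of D, and a selection phi of Phi is in D since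
    it is the limit of the functions choosing, at each point, the one among
    g_0, ..., g_n nearest to phi. *)

(** This convex function grows linearly, so its integral along the quotients stays bounded even
    when, as for p = 1, only their L^1 norms are bounded. A quadratic energy would require p = 2.
    Being strictly convex, it still separates moderate values, and uniform integrability disposes of
    the large ones; one argument thus serves every p. What shapes the second half is that each
    property of D holds only off a null set depending on the densities involved, whereas Phi is
    defined point by point. Everything is therefore reduced to countably many densities, rational
    centres and rational coefficients, whose null sets can be collected in one. Sup-norm closedness
    of L suffices because the L^1 distance of two densities bounds the sup distance of their
    primitives. Gluing also makes the pointwise maximum of finitely many norms the norm of a single
    density, so the uniform L^p bound on D passes to a common dominating function. *)

(* The Bregman divergence of the strictly convex function sqrt(1 + x^2). *)
Definition bregman {R : rcfType} (x y : R) : R :=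
  Num.sqrt (1 + y ^+ 2) - Num.sqrt (1 + x ^+ 2)
  - x / Num.sqrt (1 + x ^+ 2) * (y - x).

(** With a, b the two square roots and w = ab, the divergence is (w - (1 + xy)) / a, and w^2 - (1 +
    xy)^2 = (x - y)^2. The bound then amounts to (w - (1 + xy))^2 >= 0. *)
Lemma bregman_lb (R : rcfType) (x y : R) :
  (x - y) ^+ 2 <=
  2 * (1 + x ^+ 2) * Num.sqrt (1 + y ^+ 2) * bregman x y.
Proof.
have hx : 0 < 1 + x ^+ 2 by nra.
have hy : 0 < 1 + y ^+ 2 by nra.
rewrite /bregman; set a := Num.sqrt (1 + x ^+ 2); set b := Num.sqrt (1 + y ^+ 2).
have a0 : 0 < a by rewrite sqrtr_gt0.
have b0 : 0 < b by rewrite sqrtr_gt0.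
have ea : a ^+ 2 = 1 + x ^+ 2 by rewrite sqr_sqrtr ?ltW.
have eb : b ^+ 2 = 1 + y ^+ 2 by rewrite sqr_sqrtr ?ltW.
rewrite -ea.
have -> : 2 * a ^+ 2 * b * (b - a - x / a * (y - x)) =
  2 * (a * b) * (a * b - (a ^+ 2 + x * (y - x))).
  by field; rewrite gt_eqF.
set w := a * b.
have w0 : 0 < w by rewrite mulr_gt0.
have ew : w ^+ 2 = (1 + x ^+ 2) * (1 + y ^+ 2) by rewrite exprMn ea eb.
rewrite ea; have := sqr_ge0 (w - (1 + x * y)); rewrite sqrrB; nra.
Qed.

Lemma bregman_ge0 (R : rcfType) (x y : R) : 0 <= bregman x y.
Proof.
have hx : 0 < 1 + x ^+ 2 by nra.
have hy : 0 < 1 + y ^+ 2 by nra.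
have b0 : 0 < Num.sqrt (1 + y ^+ 2) by rewrite sqrtr_gt0.
have := bregman_lb x y; have := sqr_ge0 (x - y) => h1 h2.
have := le_trans h1 h2; rewrite pmulr_rge0 // mulr_gt0 // mulr_gt0 //.
Qed.

Lemma sqrt1D_sqr_le (R : rcfType) (x : R) : Num.sqrt (1 + x ^+ 2) <= 1 + `|x|.
Proof.
rewrite -(@ler_pXn2r _ 2) ?nnegrE ?sqrtr_ge0 ?addr_ge0 // sqr_sqrtr; last by nra.
rewrite -[x ^+ 2]real_normK ?num_real //; have := normr_ge0 x; nra.
Qed.

(** If both values are at most K in size, [bregman_lb] gives (x - y)^2 <= Q with Q = 2 (1 + K)^3
    [bregman x y], and z^2 <= Q implies z <= e + Q / e. Otherwise |x| + |y| is at most twice the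
    larger of the two, which exceeds K. *)
Lemma dist_le_bregman (R : rcfType) (x y K e : R) : 0 < e -> 0 <= K ->
  `|x - y| <= e + 2 * (1 + K) ^+ 3 / e * bregman x y
    + 2 * (if K < `|x| then `|x| else 0) + 2 * (if K < `|y| then `|y| else 0).
Proof.
move=> e0 K0.
have B0 := bregman_ge0 x y.
have Q0 : 0 <= 2 * (1 + K) ^+ 3 / e * bregman x y.
  by rewrite mulr_ge0 // divr_ge0 ?(ltW e0) // mulr_ge0 // exprn_ge0 // addr_ge0.
have nx := normr_ge0 x; have ny := normr_ge0 y; have := ler_normB x y.
case: (ltP K `|x|) => xK; case: (ltP K `|y|) => yK; try lra.
move=> _; rewrite mulr0 !addr0.
have sx : 1 + x ^+ 2 <= (1 + K) ^+ 2.
  by rewrite -[x ^+ 2]real_normK ?num_real //; nra.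
have sy : Num.sqrt (1 + y ^+ 2) <= 1 + K.
  by apply: le_trans (sqrt1D_sqr_le y) _; lra.
have b1 : (x - y) ^+ 2 <= 2 * (1 + K) ^+ 3 * bregman x y.
  apply: le_trans (bregman_lb x y) _; apply: ler_wpM2r => //.
  rewrite -!mulrA ler_pM2l // [(1 + K) ^+ 3]exprSr.
  apply: ler_pM => //; rewrite ?sqrtr_ge0 //; nra.
rewrite -[(x - y) ^+ 2]real_normK ?num_real // in b1.
set z := `|x - y| in b1 *; set Q := 2 * _ * _ in b1.
have -> : 2 * (1 + K) ^+ 3 / e * bregman x y = Q / e by rewrite /Q; ring.
rewrite -(ler_pM2r e0) mulrDl divfK ?gt_eqF //.
by nra.
Qed.

Lemma sum_nat_blocks (V : nmodType) (f : nat -> V) (n r : nat) :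
  \sum_(0 <= k < n * r) f k = \sum_(0 <= i < n) \sum_(0 <= j < r) f (i * r + j)%N.
Proof.
elim: n => [|n IH]; first by rewrite mul0n !big_geq.
rewrite big_nat_recr //= -IH mulSnr (big_cat_nat (n := n * r)) ?leq_addr //=.
congr (_ + _); rewrite -{1}[(n * r)%N]add0n big_addn addKn.
by apply: eq_bigr => i _; rewrite addnC.
Qed.

(** * Dyadic difference quotients *)

Section dyadic.
Context {R : realType} (T : R).
Hypothesis T0 : 0 < T.
Local Notation mu := (@lebesgue_measure R).

Definition mesh n : R := T / 2 ^+ n.
Definition grid n k : R := k%:R * mesh n.
Definition slope (F : R -> R) n k : R := (F (grid n k.+1) - F (grid n k)) / mesh n.
Definition pstep n (v : nat -> R) (t : R) : R :=
  \sum_(0 <= k < 2 ^ n) v k * \1_(`[grid n k, grid n k.+1[) t.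

Lemma mesh_gt0 n : 0 < mesh n.
Proof. by rewrite divr_gt0 // exprn_gt0. Qed.

Lemma gridS n k : grid n k.+1 = grid n k + mesh n.
Proof. by rewrite /grid -natr1 mulrDl mul1r. Qed.

Lemma grid0 n : grid n 0 = 0.
Proof. by rewrite /grid mul0r. Qed.

Lemma grid_max n : grid n (2 ^ n) = T.
Proof. by rewrite /grid /mesh natrX mulrC divfK // expf_neq0. Qed.

Lemma ler_grid n j k : (grid n j <= grid n k) = (j <= k)%N.
Proof. by rewrite /grid ler_pM2r ?mesh_gt0 // ler_nat. Qed.

Lemma ltr_grid n j k : (grid n j < grid n k) = (j < k)%N.
Proof. by rewrite /grid ltr_pM2r ?mesh_gt0 // ltr_nat. Qed.

Lemma mesh_refine n j : mesh n = (2 ^ j)%:R * mesh (n + j).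
Proof.
rewrite /mesh exprD natrX; field.
by rewrite !expf_neq0.
Qed.

Lemma grid_refine n j k : grid (n + j) (k * 2 ^ j) = grid n k.
Proof. by rewrite /grid (mesh_refine n j) natrM mulrA. Qed.

Lemma pstep_eq n v k t : (k < 2 ^ n)%N -> grid n k <= t < grid n k.+1 ->
  pstep n v t = v k.
Proof.
move=> kn ht; rewrite /pstep big_mkord (bigD1 (Ordinal kn)) //= big1 ?addr0.
  by rewrite indicE mem_set ?mulr1 //= in_itv.
move=> i ik; rewrite indicE memNset ?mulr0 //= in_itv /= => /andP[h1 h2].
have /andP[t1 t2] := ht.
have := le_lt_trans h1 t2; have := le_lt_trans t1 h2.
rewrite !ltr_grid !ltnS => a b; move/negP: ik; apply.
by apply/eqP/val_inj/eqP; rewrite eqn_leq a b.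
Qed.

Lemma pstep_out n v t : ~~ (0 <= t < T) -> pstep n v t = 0.
Proof.
move=> ht; rewrite /pstep big_mkord big1 // => i _.
rewrite indicE memNset ?mulr0 //= in_itv /= => /andP[h1 h2].
move/negP: ht; apply; apply/andP; split.
  by rewrite (le_trans _ h1) // -(grid0 n) ler_grid.
by rewrite (lt_le_trans h2) // -[leRHS](grid_max n) ler_grid ltn_ord.
Qed.

Lemma grid_cell n t : 0 <= t < T ->
  exists2 k, (k < 2 ^ n)%N & grid n k <= t < grid n k.+1.
Proof.
move=> /andP[t0 tT].
have q0 : 0 <= t / mesh n by rewrite divr_ge0 // ltW // mesh_gt0.
have /andP[h1 h2] := truncn_itv q0.
rewrite ler_pdivlMr ?mesh_gt0 // in h1; rewrite ltr_pdivrMr ?mesh_gt0 // in h2.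
exists (Num.truncn (t / mesh n)); last by apply/andP.
by rewrite -(ltr_grid n) grid_max; apply: le_lt_trans tT.
Qed.

Lemma pstep_cases n t : ~~ (0 <= t < T) \/
  exists2 k, (k < 2 ^ n)%N & forall v, pstep n v t = v k.
Proof.
have [/(grid_cell n)[k kn hk]|h] := boolP (0 <= t < T); [right|by left].
by exists k => // v; apply: pstep_eq.
Qed.

Lemma pstep_refine n j v : pstep n v = pstep (n + j) (fun k => v (k %/ 2 ^ j)%N).
Proof.
apply/funext => t.
have [/(grid_cell (n + j))[k kn /andP[h1 h2]]|h] := boolP (0 <= t < T); last first.
  by rewrite !pstep_out.
have p0 : (0 < 2 ^ j)%N by rewrite expn_gt0.
rewrite (@pstep_eq (n + j) _ k) //; last by apply/andP.
apply: pstep_eq; first by rewrite ltn_divLR // -expnD.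
rewrite -!(grid_refine n j) (le_trans _ h1) ?ler_grid ?leq_trunc_div //=.
by rewrite (lt_le_trans h2) // ler_grid ltn_ceil.
Qed.

Lemma measurable_pstep n v : measurable_fun setT (pstep n v).
Proof.
by apply: measurable_sum => k; apply: measurable_funM.
Qed.

Lemma integrable_indic_cell (n k : nat) (a b : R) :
  mu.-integrable `[a, b] (EFin \o \1_(`[grid n k, grid n k.+1[)).
Proof.
exact: integrableS (integrable_indic_itv (grid n k) (grid n k.+1) true true).
Qed.

Lemma integrable_cell (n k : nat) (a b c : R) :
  mu.-integrable `[a, b] (fun x => (c * \1_(`[grid n k, grid n k.+1[) x)%:E).
Proof.
have H := integrable_indic_cell n k a b.
have -> : (fun x => (c * \1_(`[grid n k, grid n k.+1[) x)%:E) =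
  (fun x => c%:E * (EFin \o \1_(`[grid n k, grid n k.+1[)) x)%E.
  by apply/funext => x; rewrite /= EFinM.
exact: integrableZl.
Qed.

Lemma integrable_pstep n v (a b : R) : mu.-integrable `[a, b] (EFin \o pstep n v).
Proof.
rewrite [X in integrable _ _ X](_ : _ = fun x => (\sum_(0 <= k < 2 ^ n)
  (v k * \1_(`[grid n k, grid n k.+1[) x)%:E)%E); last first.
  by apply/funext => x; rewrite /= sumEFin.
by apply: integrable_sum => // k _; exact: integrable_cell.
Qed.

Lemma Rintegral_pstep n v m : (m <= 2 ^ n)%N ->
  \int[mu]_(t in `[0, grid n m]) pstep n v t =
  \sum_(0 <= k < m) v k * mesh n.
Proof.
move=> mn.
have cell k : (\int[mu]_(t in `[0%R, grid n m])
    (v k * \1_(`[grid n k, grid n k.+1[) t)%:E)%E =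
    (if (k < m)%N then v k * mesh n else 0)%:E.
  under eq_integral do rewrite EFinM.
  rewrite integralZl //; last exact: integrable_indic_cell.
  rewrite integral_indic //.
  have [km|km] := ltnP k m.
    rewrite (_ : _ `&` _ = `[grid n k, grid n k.+1[%classic); last first.
      apply/seteqP; split => x; rewrite /= !in_itv /=; first by case.
      move=> /andP[h1 h2]; rewrite h1 h2; split => //; apply/andP; split.
        by rewrite (le_trans _ h1) // -(grid0 n) ler_grid.
      by rewrite (le_trans (ltW h2)) // ler_grid.
    rewrite /= lebesgue_measure_itv /= lte_fin ltr_grid ltnSn gridS.
    by rewrite -EFinD addrC addKr -EFinM.
  (* For k >= m the cell meets [0, [grid n m]] at most in its left end, which happens when k = m. *)
  rewrite [X in (_ * X)%E](_ : _ = 0%E) ?mule0 //.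
      apply: (@subset_measure0 _ _ _ mu _ `[grid n k, grid n k]%classic) => //.
      - exact: measurableI.
      - move=> x; rewrite /= !in_itv /= => -[/andP[h1 _] /andP[_ h2]].
        by rewrite h1 (le_trans h2) // ler_grid.
      - by rewrite /= lebesgue_measure_itv /= ltxx.
rewrite /Rintegral; under eq_integral do rewrite -sumEFin.
rewrite integral_sum //; last by move=> k; exact: integrable_cell.
rewrite (eq_bigr _ (fun k _ => cell k)) sumEFin /=.
rewrite (big_cat_nat (n := m)) //= [X in _ + X]big1_seq ?addr0.
  by rewrite !big_nat; apply: eq_bigr => k /andP[_ ->].
by move=> k; rewrite mem_index_iota => /andP[_ /andP[mk _]]; rewrite ltnNge mk.
Qed.

Variable F : R -> R.

(** This is the martingale property of the quotients: the increments of F telescope inside a coarse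
    cell. *)
Lemma sum_slope_block n j k :
  \sum_(0 <= i < 2 ^ j) slope F (n + j) (k * 2 ^ j + i) * mesh (n + j) =
  slope F n k * mesh n.
Proof.
have m0 i : mesh i != 0 by rewrite gt_eqF // mesh_gt0.
under eq_bigr do rewrite /slope divfK // -addnS.
rewrite (telescope_sumr (fun i => F (grid (n + j) (k * 2 ^ j + i)))) //.
rewrite addn0 -mulSnr !grid_refine /slope divfK //.
Qed.

Definition big_slopes (K : R) (n : nat) : R :=
  \sum_(0 <= k < 2 ^ n)
    (if K < `|slope F n k| then `|slope F n k| else 0) * mesh n.

Definition uniformly_integrable_slopes : Prop :=
  forall e : R, 0 < e -> exists2 K, 0 <= K & forall n, big_slopes K n <= e.

Hypothesis UI : uniformly_integrable_slopes.

Definition energy n : R :=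
  \sum_(0 <= k < 2 ^ n) Num.sqrt (1 + slope F n k ^+ 2) * mesh n.

Lemma sum_mesh n : \sum_(0 <= k < 2 ^ n) mesh n = T.
Proof.
by rewrite sumr_const_nat subn0 -mulr_natl -(grid_max n).
Qed.

(** By linear growth, sqrt(1 + x^2) is at most 1 + K plus the part of |x| above the threshold K, and
    uniform integrability bounds the sums of that part. *)
Lemma energy_bounded : exists C, forall n, energy n <= C.
Proof.
have [K K0 hK] := UI ltr01.
exists ((1 + K) * T + 1) => n.
apply: (@le_trans _ _ ((1 + K) * T + big_slopes K n)); last by rewrite lerD2l.
rewrite -(sum_mesh n) mulr_sumr /big_slopes -big_split /=.
apply: ler_sum => k _; rewrite -mulrDl ler_pM2r ?mesh_gt0 //.
apply: le_trans (sqrt1D_sqr_le _) _.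
by case: ltP => h; lra.
Qed.

Lemma sum_refine (G : nat -> R) n j :
  \sum_(0 <= k < 2 ^ (n + j)) G (k %/ 2 ^ j)%N * mesh (n + j) =
  \sum_(0 <= k < 2 ^ n) G k * mesh n.
Proof.
rewrite expnD sum_nat_blocks; apply: eq_bigr => i _.
rewrite (mesh_refine n j) mulrA mulrAC -[LHS]mulr1 mulr_natr -[RHS]mulr_natr.
rewrite mulr1 !big_mkord (eq_bigr (fun=> G i * mesh (n + j))).
  by rewrite sumr_const card_ord mulr_natr.
by move=> l _; rewrite divnMDl ?expn_gt0 // divn_small // addn0.
Qed.

(** The linear term of the divergence has a coefficient that is constant on each coarse cell, so by
    the martingale property it sums to 0 there; only the difference of energies remains. *)
Lemma sum_bregman n j :
  \sum_(0 <= k < 2 ^ (n + j))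
    bregman (slope F n (k %/ 2 ^ j)) (slope F (n + j) k) * mesh (n + j) =
  energy (n + j) - energy n.
Proof.
pose S (x : R) := Num.sqrt (1 + x ^+ 2); pose D (x : R) := x / S x.
have -> : energy n = \sum_(0 <= k < 2 ^ (n + j))
    S (slope F n (k %/ 2 ^ j)) * mesh (n + j).
  by rewrite (sum_refine (fun k => S (slope F n k))).
have E0 : \sum_(0 <= k < 2 ^ (n + j)) D (slope F n (k %/ 2 ^ j)) *
    (slope F (n + j) k - slope F n (k %/ 2 ^ j)) * mesh (n + j) = 0.
  transitivity (\sum_(0 <= k < 2 ^ (n + j))
     D (slope F n (k %/ 2 ^ j)) * slope F (n + j) k * mesh (n + j) -
    \sum_(0 <= k < 2 ^ (n + j))
     (D (slope F n (k %/ 2 ^ j)) * slope F n (k %/ 2 ^ j)) * mesh (n + j)).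
    by rewrite -sumrB; apply: eq_bigr => k _; rewrite mulrBr mulrBl.
  rewrite (sum_refine (fun k => D (slope F n k) * slope F n k)).
  rewrite expnD sum_nat_blocks -sumrB big1 // => i _.
  rewrite -mulrA -(sum_slope_block n j i) mulr_sumr -sumrB big_nat big1 //.
  move=> l /andP[_ hl].
  by rewrite divnMDl ?expn_gt0 // divn_small // addn0 mulrA subrr.
rewrite /energy -sumrB -[RHS]subr0 -[X in _ - X]E0 -sumrB.
by apply: eq_bigr => k _; rewrite /bregman -!mulrBl.
Qed.

Lemma energy_nd n j : energy n <= energy (n + j).
Proof.
rewrite -subr_ge0 -sum_bregman; apply: sumr_ge0 => k _.
by rewrite mulr_ge0 ?bregman_ge0 // ltW // mesh_gt0.
Qed.

Lemma energy_cauchy (e : R) : 0 < e ->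
  exists N, forall n j, (N <= n)%N -> energy (n + j) - energy n <= e.
Proof.
move=> e0; have [C hC] := energy_bounded.
have cv : cvgn energy.
  apply: nondecreasing_is_cvgn.
    by move=> i k ik; rewrite -(subnKC ik) energy_nd.
  by exists C => _ [n _ <-].
have nd : nondecreasing_seq energy.
  by move=> i k ik; rewrite -(subnKC ik) energy_nd.
have /cvgrPdist_le /(_ e e0) [N _ hN] := cv.
exists N => n j Nn; have := hN n Nn; have := nondecreasing_cvgn_le nd cv (n + j).
rewrite /=; set l := limn _ => h1 h2.
have := ler_norm (l - energy n); lra.
Qed.

Definition slope_dist n j : R :=
  \int[mu]_(t in `[0, T]) `|pstep (n + j) (slope F (n + j)) t - pstep n (slope F n) t|.

Lemma slope_distE n j : slope_dist n j = \sum_(0 <= k < 2 ^ (n + j))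
  `|slope F n (k %/ 2 ^ j) - slope F (n + j) k| * mesh (n + j).
Proof.
rewrite /slope_dist.
under eq_Rintegral => t _.
  rewrite (pstep_refine n j) (_ : `|_| = pstep (n + j)
     (fun k => `|slope F n (k %/ 2 ^ j) - slope F (n + j) k|) t); last first.
    case: (pstep_cases (n + j) t) => [h|[k kn hk]].
      by rewrite !pstep_out // subrr normr0.
    by rewrite !hk distrC.
  over.
by rewrite -{1}(grid_max (n + j)) Rintegral_pstep.
Qed.

Lemma slope_dist_cauchy (e : R) : 0 < e ->
  exists N, forall n j, (N <= n)%N -> slope_dist n j <= e.
Proof.
move=> e0; have e8 : 0 < e / 8 by rewrite divr_gt0.
have [K K0 hK] := UI e8.
(* The four terms of [dist_le_bregman] will contribute at most e/4, e/8, e/4 and e/4. *)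
pose a := e / (4 * T); have a0 : 0 < a by rewrite divr_gt0 // mulr_gt0.
pose C := 2 * (1 + K) ^+ 3 / a.
have C0 : 0 < C.
  by rewrite divr_gt0 // mulr_gt0 // exprn_gt0 // ltr_wpDr.
have [N hN] := energy_cauchy (divr_gt0 e8 C0).
exists N => n j Nn; rewrite slope_distE.
pose w (x : R) := if K < `|x| then `|x| else 0.
apply: (@le_trans _ _ (\sum_(0 <= k < 2 ^ (n + j))
  (a * mesh (n + j) + C * (bregman (slope F n (k %/ 2 ^ j)) (slope F (n + j) k) * mesh (n + j))
   + 2 * (w (slope F n (k %/ 2 ^ j)) * mesh (n + j))
   + 2 * (w (slope F (n + j) k) * mesh (n + j))))).
  apply: ler_sum => k _.
  have := mesh_gt0 (n + j); move: (mesh (n + j)) => m m0.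
  rewrite !mulrA -!mulrDl ler_pM2r //.
  exact: dist_le_bregman.
rewrite !big_split /= -[X in X + _ + _ + _]mulr_sumr -[X in _ + X + _ + _]mulr_sumr.
rewrite -[X in _ + X + _]mulr_sumr -[X in _ + X]mulr_sumr sum_mesh sum_bregman.
rewrite (sum_refine (fun k => w (slope F n k))).
have := hN n j Nn; rewrite ler_pdivlMr // => h1.
have h2 := hK n; have h3 := hK (n + j)%N; rewrite /big_slopes in h2 h3.
have -> : a * T = e / 4 by rewrite /a; field; rewrite gt_eqF.
rewrite /w; lra.
Qed.

End dyadic.

(** * Limits of rapidly Cauchy sequences in L^1 *)

Lemma summable_increments_cvg (R : realType) (u : nat -> R) :
  (\sum_(j <oo) (`|u j.+1 - u j|%:E) < +oo)%E ->
  cvgn u /\ forall n, `|u n| <= `|u 0%N| + fine (\sum_(j <oo) (`|u j.+1 - u j|%:E))%E.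
Proof.
set S := (\sum_(j <oo) _)%E => Soo.
have S0 : (0 <= S)%E by apply: nneseries_ge0 => n _ _; rewrite lee_fin.
have Sf : S \is a fin_num by rewrite ge0_fin_numE.
have partial n : \sum_(0 <= j < n) `|u j.+1 - u j| <= fine S.
  rewrite -lee_fin fineK // -sumEFin.
  by apply: nneseries_lim_ge => k _ _; rewrite lee_fin.
have tel n : u n = u 0%N + series (telescope u) n by exact: eq_sum_telescope.
split.
  have -> : u = (fun n => u 0%N + series (telescope u) n) by apply/funext.
  apply: is_cvgD; first exact: is_cvg_cst.
  apply: normed_cvg; apply: nondecreasing_is_cvgn.
    by apply: nondecreasing_series => n _ _; exact: normr_ge0.
  exists (fine S) => _ [n _ <-]; rewrite /=; exact: partial.
move=> n; rewrite [in leLHS](tel n) (le_trans (ler_normD _ _)) // lerD2l.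
by rewrite (le_trans (ler_norm_sum _ _ _)) //; exact: partial.
Qed.

Section L1_limit.
Context d (X : measurableType d) (R : realType).
Variables (mu : {measure set X -> \bar R}) (D : set X) (mD : measurable D).
Variable u : nat -> X -> R.
Hypothesis mu_ : forall n, measurable_fun setT (u n).
Hypothesis iu0 : mu.-integrable D (EFin \o u 0%N).
Hypothesis fast : forall n,
  (\int[mu]_(x in D) `|u n.+1 x - u n x|%:E <= (2 ^+ n.+1)^-1%:E)%E.

(** The sum w of all absolute increments has finite integral, hence is finite almost everywhere.
    There the sequence converges, and |u_0| + w dominates it. *)
Lemma L1_limit : exists v : X -> R, [/\ measurable_fun setT v,
  mu.-integrable D (EFin \o v) &
  forall E, measurable E -> E `<=` D ->
    (\int[mu]_(x in E) (u n x)%:E)%E @[n --> \oo] --> (\int[mu]_(x in E) (v x)%:E)%E].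
Proof.
pose w x := (\sum_(j <oo) (`|u j.+1 x - u j x|%:E))%E.
have mi n : measurable_fun setT (fun x => `|u n.+1 x - u n x|%:E).
  by apply/measurable_EFinP; apply: measurableT_comp => //; exact: measurable_funB.
have miD n : measurable_fun D (fun x => `|u n.+1 x - u n x|%:E).
  exact: measurable_funTS.
have w0 x : (0 <= w x)%E by apply: nneseries_ge0 => n _ _; rewrite lee_fin.
have mw : measurable_fun D w.
  by apply: ge0_emeasurable_sum => // k x _ _; rewrite lee_fin.
have iw : mu.-integrable D w.
  apply/integrableP; split => //.
  under eq_integral do rewrite gee0_abs //.
  rewrite integral_nneseries //.
  apply: (@le_lt_trans _ _ (\sum_(n <oo) (1 / (2 ^ n.+1)%:R)%:E)%E).
    apply: lee_nneseries => n _; first by move=> _; apply: integral_ge0.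
    by rewrite natrX div1r.
  by apply: (le_lt_trans (epsilon_trick0 _ _)) => //; rewrite ltry.
(* The upper limit is measurable on the whole space, also where the sequence diverges. *)
pose v x := fine (limn_esup (fun n => (u n x)%:E)).
have mv : measurable_fun setT v.
  apply: measurableT_comp => //; apply: measurable_fun_limn_esup => n.
  exact/measurable_EFinP.
have wfin := integrable_ae mD iw.
have cv : {ae mu, forall x, D x -> (fun n => (u n x)%:E) @ \oo --> (v x)%:E}.
  apply: filterS wfin => x /[apply] wx.
  have [cu _] := summable_increments_cvg (u := u ^~ x)
    (ltac:(by rewrite -ge0_fin_numE) : (w x < +oo)%E).
  have cue : (fun n => (u n x)%:E) @ \oo --> (limn (u ^~ x))%:E by apply/cvg_EFin; [apply: nearW|].
  by rewrite /v (cvg_limn_einf_sup cue).2.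
pose g x := (`|u 0%N x|%:E + w x)%E.
have ig : mu.-integrable D g.
  apply: integrableD => //.
  by have := integrable_norm iu0.
have dom : {ae mu, forall x n, D x -> (`|(u n x)%:E| <= g x)%E}.
  apply: filterS wfin => x wx n /wx {}wx.
  have [_ /(_ n)] := summable_increments_cvg (u := u ^~ x)
    (ltac:(by rewrite -ge0_fin_numE) : (w x < +oo)%E).
  by rewrite -lee_fin EFinD fineK.
have key E : measurable E -> E `<=` D -> mu.-integrable E (EFin \o v) /\
    (\int[mu]_(x in E) (u n x)%:E)%E @[n --> \oo] --> (\int[mu]_(x in E) (v x)%:E)%E.
  move=> mE ED.
  have cvE : {ae mu, forall x, E x -> (fun n => (u n x)%:E) @ \oo --> (v x)%:E}.
    by apply: filterS cv => x h /ED.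
  have domE : {ae mu, forall x n, E x -> (`|(u n x)%:E| <= g x)%E}.
    by apply: filterS dom => x h n /ED; exact: h.
  have muE n : measurable_fun E (EFin \o u n).
    by apply/measurable_EFinP; exact: measurable_funTS.
  have mvE : measurable_fun E (EFin \o v).
    by apply/measurable_EFinP; exact: measurable_funTS.
  have igE : mu.-integrable E g by exact: integrableS ig.
  by have [] := dominated_convergence mE muE mvE cvE igE domE.
exists v; split => //; first by have [] := key D mD (@subset_refl _ D).
by move=> E mE ED; have [] := key E mE ED.
Qed.

End L1_limit.

(** * From dyadic quotients to a density *)

Section density.
Context {R : realType} (T : R) (T0 : 0 < T) (F : R -> R).
Local Notation mu := (@lebesgue_measure R).

(** At a fixed dyadic point the integrals of the quotients equal the increment of F at every finer
    level, so the L^1 limit of a fast subsequence inherits this value. *)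
Lemma dyadic_density : uniformly_integrable_slopes T F ->
  exists v : R -> R, [/\ measurable_fun setT v,
    mu.-integrable `[0, T] (EFin \o v) &
    forall n k, (k <= 2 ^ n)%N ->
      \int[mu]_(t in `[0, grid T n k]) v t = F (grid T n k) - F 0].
Proof.
move=> UI.
have /choice[N hN] : forall i, exists N, forall n j, (N <= n)%N ->
    slope_dist T F n j <= (2 ^+ i.+1)^-1.
  by move=> i; apply: slope_dist_cauchy => //; rewrite invr_gt0 exprn_gt0.
(* These partial sums are at least [N i] and at least i, and the successor in each summand makes
   them strictly increasing. *)
pose m i := (\sum_(0 <= l < i.+1) (N l).+1)%N.
have mS i : m i.+1 = (m i + (N i.+1).+1)%N by rewrite /m big_nat_recr.
have mN i : (N i <= m i)%N by rewrite /m big_nat_recr //= (leq_trans (leqnSn _)) // leq_addl.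
have mi i : (i <= m i)%N.
  by elim: i => // i IH; rewrite mS addnS ltnS (leq_trans IH) // leq_addr.
have [n||n|v [mv iv hv]] := @L1_limit _ _ R mu `[0, T]%classic (measurable_itv _)
  (fun i => pstep T (m i) (slope T F (m i))).
- exact: measurable_pstep.
- exact: integrable_pstep.
- have := hN n (m n) (N n.+1).+1 (mN n); rewrite /slope_dist -mS -lee_fin.
  rewrite /Rintegral fineK //.
  apply: integrable_fin_num => //=.
  apply: integrable_norm; under [X in integrable _ _ X]eq_fun do rewrite EFinB.
  by apply: integrableB => //; exact: integrable_pstep.
exists v; split => // n k kn.
have gT : grid T n k <= T by rewrite -[leRHS](grid_max T n) ler_grid.
have sub : `[0, grid T n k]%classic `<=` `[0, T]%classic.
  by move=> x; rewrite /= !in_itv /= => /andP[-> /le_trans]; apply.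
have hc := hv _ (measurable_itv `[0, grid T n k]) sub.
have ev : \forall i \near \oo,
    (\int[mu]_(x in `[0%R, grid T n k]) (pstep T (m i) (slope T F (m i)) x)%:E)%E =
    (F (grid T n k) - F 0)%:E.
  exists n => // i /= ni; have nmi := leq_trans ni (mi i).
  rewrite -[LHS]fineK; last first.
    by apply: integrable_fin_num => //; exact: integrable_pstep.
  rewrite -/(Rintegral _ _ _) -(subnKC nmi); congr EFin.
  rewrite -(grid_refine T n (m i - n) k) Rintegral_pstep //; last first.
    by rewrite expnD leq_pmul2r // expn_gt0.
  under eq_bigr do rewrite /slope divfK ?(gt_eqF (mesh_gt0 T0 _)) //.
  by rewrite (telescope_sumr (fun i => F (grid T _ i))) // grid0.
have hc' := cvg_trans (near_eq_cvg ev) hc.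
have := cvg_unique (@ereal_hausdorff R) (hc' _) (cvg_cst _).
by rewrite /Rintegral => ->.
Qed.

(** Continuity is relative to [a, b] because functions are extended by 0 outside [0, T] and may jump
    at the ends. *)
Definition continuous_within (a b : R) (G : R -> R) : Prop :=
  forall t, a <= t <= b -> forall e, 0 < e -> exists2 del, 0 < del &
    forall s, a <= s <= b -> `|s - t| < del -> `|G s - G t| < e.

Lemma continuous_within_integral (v : R -> R) :
  mu.-integrable `[0, T] (EFin \o v) ->
  continuous_within 0 T (fun t => \int[mu]_(s in `[0, t]) v s).
Proof.
move=> iv t tT e e0.
have iT : mu.-integrable setT (EFin \o (v \_ `[0, T])).
  by have := iv; rewrite integrable_mkcond //= restrict_EFin.
have [del [del0 hdel]] := integral_normr_continuous iT e0.
exists del => // s sT std.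
have key a b : 0 <= a -> a <= b -> b <= T -> b - a < del ->
    `|\int[mu]_(x in `[0, b]) v x - \int[mu]_(x in `[0, a]) v x| < e.
  move=> a0 ab bT bad.
  have sub : `]a, b]%classic `<=` `[0, T]%classic.
    move=> x; rewrite /= !in_itv /= => /andP[h1 h2].
    by rewrite (le_trans a0 (ltW h1)) (le_trans h2).
  have sub' : `[0, b]%classic `<=` `[0, T]%classic.
    by move=> x; rewrite /= !in_itv /= => /andP[-> h2]; rewrite (le_trans h2).
  rewrite Rintegral_itvB ?bnd_simp //; last exact: integrableS iv.
  apply: le_lt_trans (le_normr_Rintegral _ _) _ => //; first exact: integrableS iv.
  have := hdel _ (measurable_itv `]a, b]).
  rewrite /= lebesgue_measure_itv /= => /(_ _)/le_lt_trans; apply; last first.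
    by case: ifP => _; rewrite ?lte_fin // -EFinD lte_fin.
  rewrite le_eqVlt; apply/orP; left; apply/eqP.
  apply: eq_Rintegral => x; rewrite inE => /sub xT; rewrite patchE mem_set //.
have /andP[t0 tT'] := tT; have /andP[s0 sT'] := sT.
case: (leP t s) => ts.
  by apply: key => //; move: std; rewrite ger0_norm ?subr_ge0.
rewrite distrC; apply: key => //; first exact: ltW.
by move: std; rewrite distrC ger0_norm ?subr_ge0 // ltW.
Qed.

(** Both sides are continuous on [0, T] and agree at the dyadic points, which are dense. *)
Lemma continuous_within_density v : continuous_within 0 T F ->
  mu.-integrable `[0, T] (EFin \o v) ->
  (forall n k, (k <= 2 ^ n)%N ->
      \int[mu]_(t in `[0, grid T n k]) v t = F (grid T n k) - F 0) ->
  forall t, 0 <= t <= T -> F t = F 0 + \int[mu]_(s in `[0, t]) v s.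
Proof.
move=> cF iv hv t tT; have cG := continuous_within_integral iv.
apply/eqP; rewrite -subr_eq0 -normr_le0; apply/ler_addgt0Pl => e e0.
have e20 : 0 < e / 2 by rewrite divr_gt0.
have [d1 d10 h1] := cF t tT (e / 2) e20.
have [d2 d20 h2] := cG t tT (e / 2) e20.
suff [s sT [s1 s2 s3]] : exists2 s, 0 <= s <= T & [/\ `|s - t| < d1, `|s - t| < d2
    & \int[mu]_(x in `[0, s]) v x = F s - F 0].
  have := h1 s sT s1; have := h2 s sT s2; rewrite s3.
  set I := Rintegral _ _ _.
  rewrite !ltr_norml ler_norml => /andP[a1 a2] /andP[b1 b2]; apply/andP; split; lra.
have /andP[t0 tleT] := tT.
(* No half-open cell contains T, but T is itself a grid point. *)
have [->|tnT] := eqVneq t T.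
  exists T; first by rewrite lexx ltW.
  rewrite subrr normr0 d10 d20; split => //.
  by have := hv 0 1 (leqnn _); rewrite [grid T 0 1](grid_max T 0).
have tlT : t < T by rewrite lt_neqAle tnT.
have dd : 0 < Num.min d1 d2 / T by rewrite divr_gt0 // lt_min d10.
have [n hn] : exists n, mesh T n < Num.min d1 d2.
  exists (Num.truncn (Num.min d1 d2 / T)^-1).+1.
  rewrite /mesh ltr_pdivrMr ?exprn_gt0 // -ltr_pdivrMl; last by rewrite lt_min d10.
  rewrite mulrC -invf_div.
  apply: (lt_le_trans (truncnS_gt _)).
  by rewrite -natrX ler_nat ltnW // ltn_expl.
have [k kn /andP[k1 k2]] := grid_cell T0 n (ltac:(by rewrite t0 tlT) : 0 <= t < T).
rewrite gridS in k2; have h : `|grid T n k - t| < Num.min d1 d2.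
  by rewrite distrC ger0_norm ?subr_ge0 //; lra.
exists (grid T n k).
  rewrite (le_trans k1 (ltW tlT)) andbT -(grid0 T n) ler_grid //.
move: h; rewrite lt_min => /andP[ha hb]; split => //.
by apply: hv; exact: ltnW.
Qed.

End density.

(** * The l1 norm and the Riesz variation *)

Section norm1.
Context {R : realType} {d : nat}.
Implicit Types x y z : 'rV[R]_d.

(** A plain sum over the coordinates, which reduces measurability and integrals to the scalar case.
    It is equivalent to the Euclidean norm, with factors 1 and d. *)
Definition norm1 x : R := \sum_i `|x 0 i|.

Lemma norm1_ge0 x : 0 <= norm1 x.
Proof. exact: sumr_ge0. Qed.

Lemma enorm_ge0 x : 0 <= enorm x.
Proof. exact: sqrtr_ge0. Qed.

Lemma norm1_0 : norm1 0 = 0.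
Proof. by rewrite /norm1 big1 // => i _; rewrite mxE normr0. Qed.

Lemma norm1N x : norm1 (- x) = norm1 x.
Proof. by apply: eq_bigr => i _; rewrite mxE normrN. Qed.

Lemma norm1B x y : norm1 (x - y) = norm1 (y - x).
Proof. by rewrite -norm1N opprB. Qed.

Lemma norm1_triangle x y : norm1 (x + y) <= norm1 x + norm1 y.
Proof.
by rewrite -big_split /=; apply: ler_sum => i _; rewrite mxE; exact: ler_normD.
Qed.

Lemma norm1_dist_triangle x y z : norm1 (x - z) <= norm1 (x - y) + norm1 (y - z).
Proof. by apply: le_trans (norm1_triangle _ _); rewrite addrA subrK. Qed.

Lemma norm1Z a x : norm1 (a *: x) = `|a| * norm1 x.
Proof. by rewrite mulr_sumr; apply: eq_bigr => i _; rewrite mxE normrM. Qed.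

Lemma coord_le_norm1 x i : `|x 0 i| <= norm1 x.
Proof. by rewrite /norm1 (bigD1 i) //= lerDl sumr_ge0. Qed.

Lemma coord_le_enorm x i : `|x 0 i| <= enorm x.
Proof.
rewrite -sqrtr_sqr ler_sqrt; last by apply: sumr_ge0 => j _; exact: sqr_ge0.
by rewrite (bigD1 i) //= lerDl sumr_ge0 // => j _; exact: sqr_ge0.
Qed.

Lemma norm1_le_enorm x : norm1 x <= d%:R * enorm x.
Proof.
apply: (@le_trans _ _ (\sum_(i < d) enorm x)); first by apply: ler_sum => i _; exact: coord_le_enorm.
by rewrite sumr_const card_ord mulr_natl.
Qed.

Lemma enorm_le_norm1 x : enorm x <= norm1 x.
Proof.
rewrite -(ger0_norm (norm1_ge0 x)) -sqrtr_sqr ler_sqrt ?sqr_ge0 // expr2.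
rewrite {1}/norm1 mulr_suml; apply: ler_sum => i _.
by rewrite -[x 0 i ^+ 2]real_normK ?num_real // expr2 ler_wpM2l // coord_le_norm1.
Qed.

End norm1.

Section riesz.
Context {R : realType} {d : nat}.
Variables (T p : R) (f : R -> 'rV[R]_d).
Hypotheses (T0 : 0 < T) (p1 : 1 <= p).

Definition riesz_term (a b : R) : R :=
  enorm (f b - f a) `^ p / (b - a) `^ (p - 1).

Lemma riesz_term_ge0 a b : 0 <= riesz_term a b.
Proof. by rewrite divr_ge0 ?powR_ge0. Qed.

Lemma sum_consecutive_cons (E : R -> R -> R) (a b : R) (s : seq R) :
  \sum_(0 <= i < size (b :: s)) E (nth 0 (a :: b :: s) i) (nth 0 (a :: b :: s) i.+1) =
  E a b + \sum_(0 <= i < size s) E (nth 0 (b :: s) i) (nth 0 (b :: s) i.+1).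
Proof. by rewrite /= big_nat_recl. Qed.

Variable V : R.
Hypothesis hV : forall s, itv_partition 0 T s -> riesz_sum p f s <= V.

Lemma riesz_term_le a b : 0 <= a -> a < b -> b <= T -> riesz_term a b <= V.
Proof.
move=> a0 ab bT.
(* Partitions increase strictly, so 0, a, b, T is used with coinciding points dropped. *)
pose s1 := if b == T then [::] else [:: T].
have h1 : riesz_term a b <= \sum_(0 <= i < size (b :: s1))
     riesz_term (nth 0 (a :: b :: s1) i) (nth 0 (a :: b :: s1) i.+1).
  by rewrite sum_consecutive_cons lerDl sumr_ge0 // => i _; exact: riesz_term_ge0.
have P1 : path <%O b s1 /\ last b s1 = T.
  rewrite /s1; case: eqVneq => [->//|bT'] /=.
  by rewrite andbT lt_neqAle bT' bT.
have [a_eq0|an0] := eqVneq a 0.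
  apply: le_trans h1 _; rewrite a_eq0; apply: (hV (s := b :: s1)).
  by rewrite /itv_partition /= P1.1 P1.2 eqxx -a_eq0 ab.
have a0' : 0 < a by rewrite lt_neqAle eq_sym an0.
apply: (@le_trans _ _ (riesz_sum p f (a :: b :: s1))).
  rewrite [riesz_sum _ _ _](sum_consecutive_cons riesz_term).
  by apply: le_trans h1 _; rewrite lerDr riesz_term_ge0.
by apply: hV; rewrite /itv_partition /= a0' ab P1.1 P1.2.
Qed.

Lemma riesz_sum_grid n :
  \sum_(0 <= k < 2 ^ n) riesz_term (grid T n k) (grid T n k.+1) <= V.
Proof.
pose s := [seq grid T n k.+1 | k <- iota 0 (2 ^ n)].
have sz : size s = (2 ^ n)%N by rewrite size_map size_iota.
have nths i : (i <= 2 ^ n)%N -> nth 0 (0 :: s) i = grid T n i.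
  case: i => [|i] /= hi; first by rewrite grid0.
  by rewrite (nth_map 0%N) ?size_iota // nth_iota.
apply: le_trans (hV (s := s) _).
  rewrite /riesz_sum sz !big_nat; apply: ler_sum => k /andP[_ hk].
  by rewrite !nths // ltnW.
split; first apply/(pathP 0).
  rewrite sz => i hi; have := nths i.+1 hi; rewrite /= => ->.
  by rewrite nths 1?ltnW // ltr_grid.
by rewrite (last_nth 0) sz nths // grid_max.
Qed.

Lemma riesz_term_grid n k :
  riesz_term (grid T n k) (grid T n k.+1) =
  (enorm (f (grid T n k.+1) - f (grid T n k)) / mesh T n) `^ p * mesh T n.
Proof.
have m0 := mesh_gt0 T0 n.
rewrite /riesz_term gridS addrAC subrr add0r.
rewrite powRM ?enorm_ge0 ?invr_ge0 ?(ltW m0) // -mulrA; congr (_ * _).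
have p0 : 0 < p := lt_le_trans ltr01 p1.
rewrite -[(mesh T n)^-1]powR_inv1 ?(ltW m0) // -powRrM mulN1r powRN -(mulr_powRB1 (ltW m0) p0).
by rewrite invfM mulrAC mulVf ?mul1r // gt_eqF.
Qed.

Variable i : 'I_d.
Local Notation F := (fun t => f t 0 i).

Lemma slope_le n k :
  `|slope T F n k| <= enorm (f (grid T n k.+1) - f (grid T n k)) / mesh T n.
Proof.
have m0 := mesh_gt0 T0 n.
rewrite /slope normrM [X in _ * X]ger0_norm ?invr_ge0 ?(ltW m0) //.
apply: ler_wpM2r; first by rewrite invr_ge0 ltW.
by have := coord_le_enorm (f (grid T n k.+1) - f (grid T n k)) i; rewrite !mxE.
Qed.

Lemma sum_slope_powR n : \sum_(0 <= k < 2 ^ n) `|slope T F n k| `^ p * mesh T n <= V.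
Proof.
apply: le_trans (riesz_sum_grid n); apply: ler_sum => k _.
rewrite riesz_term_grid ler_pM2r ?mesh_gt0 //.
rewrite ge0_ler_powR ?nnegrE ?slope_le ?(le_trans ler01 p1) //.
by rewrite divr_ge0 ?enorm_ge0 ?ltW ?mesh_gt0.
Qed.

(** For |x| > K one has |x| K^(p-1) <= |x|^p, so the large slopes sum to at most V / K^(p-1). The
    choice K^(p-1) = V/e + 1 makes this at most e, the added 1 keeping K positive when V = 0. *)
Lemma slopes_ui_gt1 : 1 < p -> uniformly_integrable_slopes T F.
Proof.
move=> p1' e e0.
have V0 : 0 <= V.
  by apply: le_trans (riesz_sum_grid 0); apply: sumr_ge0 => k _; exact: riesz_term_ge0.
have q0 : 0 < p - 1 by rewrite subr_gt0.
have Ve : 0 < V / e + 1 by rewrite ltr_wpDl // divr_ge0 // ltW.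
exists ((V / e + 1) `^ (p - 1)^-1) => [|n]; first exact: powR_ge0.
set K := _ `^ _.
have K0 : 0 < K by rewrite powR_gt0.
have Kp : K `^ (p - 1) = V / e + 1.
  by rewrite /K -powRrM mulVf ?gt_eqF // powRr1 // ltW.
have m0 := mesh_gt0 T0 n.
rewrite -(ler_pM2r Ve); apply: (@le_trans _ _ V); last first.
  by rewrite mulrDr mulrCA divff ?gt_eqF // !mulr1 lerDl ltW.
apply: le_trans (sum_slope_powR n); rewrite /big_slopes mulr_suml.
apply: ler_sum => k _; rewrite -Kp mulrAC ler_pM2r //.
case: ltP => xK; last by rewrite mul0r powR_ge0.
have x0 := lt_trans K0 xK.
rewrite -[leRHS]mulr_powRB1 ?(ltW x0) //; last by lra.
by rewrite ler_pM2l // ge0_ler_powR ?nnegrE ?ltW.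
Qed.

(** By Chebyshev's inequality the cells with slope above K have total length at most V / K < [del],
    and absolute continuity bounds the increments over them. *)
Lemma slopes_ui_1 : p = 1 -> abs_continuous T f -> uniformly_integrable_slopes T F.
Proof.
move=> pE ac e e0; have [del del0 hdel] := ac e e0.
have V0 : 0 <= V.
  by apply: le_trans (riesz_sum_grid 0); apply: sumr_ge0 => k _; exact: riesz_term_ge0.
have K0 : 0 < (V + 1) / del by rewrite divr_gt0 // ltr_wpDl.
exists ((V + 1) / del) => [|n]; first exact: ltW.
set K := _ / del.
have m0 := mesh_gt0 T0 n.
have KV : K * \sum_(0 <= k < 2 ^ n) (if K < `|slope T F n k| then mesh T n else 0) <= V.
  apply: le_trans (sum_slope_powR n); rewrite mulr_sumr; apply: ler_sum => k _.
  rewrite pE powRr1 //; case: ltP => h; first by rewrite ler_pM2r // ltW.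
  by rewrite mulr0 mulr_ge0 // ltW.
(* All cells are listed; one with small slope is collapsed to a point by v k = u k, so that it adds
   neither length nor increment. *)
pose u (k : 'I_(2 ^ n)) := grid T n k.
pose v (k : 'I_(2 ^ n)) := if K < `|slope T F n k| then grid T n k.+1 else grid T n k.
have := hdel _ u v; rewrite /big_slopes big_mkord => H.
have vS k : v k <= grid T n k.+1 by rewrite /v; case: ifP => // _; rewrite ler_grid.
apply: le_trans (ltW (H _ _ _)).
- apply: ler_sum => k _; rewrite /v; case: ltP => h.
    rewrite -ler_pdivlMr //; exact: slope_le.
  by rewrite mul0r enorm_ge0.
- move=> k; split; first by rewrite -(grid0 T n) ler_grid.
  split; first by rewrite /v; case: ifP => // _; rewrite ler_grid.
  by rewrite (le_trans (vS k)) // -[leRHS](grid_max T n) ler_grid.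
- move=> j k jk; have [h|h] := ltnP j k; [left|right].
    by rewrite (le_trans (vS j)) // ler_grid.
  rewrite (le_trans (vS k)) // ler_grid // ltn_neqAle h andbT.
  by rewrite eq_sym; apply: contra jk => /eqP/val_inj ->.
- rewrite -(ltr_pM2l K0).
  apply: (@le_lt_trans _ _ V); last by rewrite /K divfK ?gt_eqF // ltrDl.
  apply: le_trans KV; rewrite big_mkord ler_pM2l //.
  apply: ler_sum => k _; rewrite /v /u; case: ifP => _; last by rewrite subrr.
  by rewrite gridS addrAC subrr add0r.
Qed.

(** A single Riesz term bounds |F b - F a|^p by V (b - a)^(p-1), which is a Hölder estimate; [del]
    solves del^(p-1) = e^p / (V + 1). *)
Lemma continuous_within_gt1 : 1 < p -> continuous_within 0 T F.
Proof.
move=> p1' t tT e e0.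
have V0 : 0 <= V.
  by apply: le_trans (riesz_sum_grid 0); apply: sumr_ge0 => k _; exact: riesz_term_ge0.
have q0 : 0 < p - 1 by rewrite subr_gt0.
have p0 : 0 < p := lt_le_trans ltr01 p1.
pose w := e `^ p / (V + 1).
have w0 : 0 < w by rewrite divr_gt0 ?powR_gt0 // ltr_wpDl.
exists (w `^ (p - 1)^-1) => [|s sT]; first by rewrite powR_gt0.
set del := _ `^ _ => std.
have Kp : del `^ (p - 1) = w.
  by rewrite /del -powRrM mulVf ?gt_eqF // powRr1 // ltW.
have key a b : 0 <= a -> a < b -> b <= T -> b - a < del -> `|F b - F a| < e.
  move=> a0 ab bT bad.
  apply: (@le_lt_trans _ _ (enorm (f b - f a))).
    by have := coord_le_enorm (f b - f a) i; rewrite !mxE.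
  rewrite ltNge; apply/negP => eE.
  have h := riesz_term_le a0 ab bT.
  have ba0 : 0 < b - a by rewrite subr_gt0.
  rewrite /riesz_term ler_pdivrMr ?powR_gt0 // in h.
  have h1 : e `^ p <= enorm (f b - f a) `^ p.
    by rewrite ge0_ler_powR ?nnegrE ?enorm_ge0 // ltW.
  have h2 : (b - a) `^ (p - 1) <= w.
    by rewrite -Kp ge0_ler_powR ?nnegrE ?powR_ge0 // ltW.
  have : e `^ p <= V * w by rewrite (le_trans h1) // (le_trans h) // ler_wpM2l.
  have ep : 0 < e `^ p by rewrite powR_gt0.
  have V1 : 0 < V + 1 by rewrite ltr_wpDl.
  rewrite /w mulrA ler_pdivlMr //; nra.
have /andP[t0 tT'] := tT; have /andP[s0 sT'] := sT.
case: (ltgtP t s) => ts.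
- by apply: key => //; move: std; rewrite gtr0_norm ?subr_gt0.
- by rewrite distrC; apply: key => //; move: std; rewrite distrC gtr0_norm ?subr_gt0.
- by rewrite ts subrr normr0.
Qed.

End riesz.

Lemma continuous_within_ac (R : realType) (d : nat) (T : R) (f : R -> 'rV[R]_d) (i : 'I_d) :
  abs_continuous T f -> continuous_within 0 T (fun t => f t 0 i).
Proof.
move=> ac t tT e e0; have [del del0 hdel] := ac e e0.
have key a b : 0 <= a -> a <= b -> b <= T -> b - a < del -> `|f b 0 i - f a 0 i| < e.
  move=> a0 ab bT bad.
  have /= := hdel 1%N (fun=> a) (fun=> b); rewrite !big_ord1 => H.
  apply: (@le_lt_trans _ _ (enorm (f b - f a))).
    by have := coord_le_enorm (f b - f a) i; rewrite !mxE.
  apply: H => // j k; by rewrite !ord1 eqxx.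
exists del => // s sT std.
have /andP[t0 tT'] := tT; have /andP[s0 sT'] := sT.
case: (leP t s) => ts.
  by apply: key => //; move: std; rewrite ger0_norm ?subr_ge0.
rewrite distrC; apply: key => //; first exact: ltW.
by move: std; rewrite distrC ger0_norm ?subr_ge0 // ltW.
Qed.

Lemma riesz_variation_bound (R : realType) (d : nat) (T p V : R) (f : R -> 'rV[R]_d) :
  (riesz_variation T p f <= V%:E)%E <->
  (forall s, itv_partition 0 T s -> riesz_sum p f s <= V).
Proof.
split=> [h s hs|h].
  by rewrite -lee_fin; apply: le_trans h; apply: ereal_sup_ubound; exists s.
by apply: ge_ereal_sup => _ [s hs <-]; rewrite lee_fin h.
Qed.

Lemma riesz_variation_ge0 (R : realType) (d : nat) (T p : R) (f : R -> 'rV[R]_d) :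
  0 < T -> (0 <= riesz_variation T p f)%E.
Proof.
move=> T0; apply: (@le_trans _ _ (riesz_sum p f [:: T])%:E); last first.
  by apply: ereal_sup_ubound; exists [:: T] => //; split; rewrite /= ?T0.
by rewrite lee_fin; apply: sumr_ge0 => k _; rewrite divr_ge0 ?powR_ge0.
Qed.

Lemma BVp_density (R : realType) (d : nat) (T p : R) (f : R -> 'rV[R]_d) :
  0 < T -> 1 <= p -> BVp T p f -> (p = 1 -> abs_continuous T f) ->
  exists phi : R -> 'rV[R]_d, [/\
    forall i, measurable_fun setT (fun s => phi s 0 i),
    forall i, (@lebesgue_measure R).-integrable `[0, T] (fun s => (phi s 0 i)%:E) &
    forall t, 0 <= t <= T -> f t = f 0 + vintegral phi t].
Proof.
move=> T0 p1 [_ fV] ac.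
have vfin : riesz_variation T p f \is a fin_num.
  by rewrite ge0_fin_numE // riesz_variation_ge0.
have hV : forall s, itv_partition 0 T s -> riesz_sum p f s <= fine (riesz_variation T p f).
  by apply/riesz_variation_bound; rewrite fineK.
have /choice[v hv] : forall i : 'I_d, exists v : R -> R, [/\ measurable_fun setT v,
    (@lebesgue_measure R).-integrable `[0, T] (EFin \o v) &
    forall t, 0 <= t <= T ->
      f t 0 i = f 0 0 i + \int[(@lebesgue_measure R)]_(s in `[0, t]) v s].
  move=> i.
  have [ui cf] : uniformly_integrable_slopes T (fun t => f t 0 i) /\
      continuous_within 0 T (fun t => f t 0 i).
    have [pE|pn1] := eqVneq p 1.
      split; last by apply: continuous_within_ac; exact: ac.
      by apply: (slopes_ui_1 T0 p1 hV) => //; exact: ac.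
    have p1' : 1 < p by rewrite lt_neqAle eq_sym pn1.
    split; first exact: (slopes_ui_gt1 T0 p1 hV).
    exact: (continuous_within_gt1 T0 p1 hV).
  have [v [mv iv h]] := dyadic_density T0 ui.
  exists v; split => // t tT.
  exact: (continuous_within_density T0 cf iv h).
exists (fun s => \row_i v i s); split.
- by move=> i; under eq_fun do rewrite mxE; have [] := hv i.
- move=> i; have [_ + _] := hv i; apply: eq_integrable => // s _.
  by rewrite mxE.
- move=> t tT; apply/rowP => i; rewrite !mxE; have [_ _ ->] := hv i => //.
  by congr (_ + _); apply: eq_Rintegral => s _; rewrite mxE.
Qed.

(** * Primitives of densities *)

Section integral_off_null_set.
Import HBNNSimple.

(* No measurability of f and g: derive1 is not known to be measurable. *)
Lemma integral_off_null_set d (X : measurableType d) (R : realType)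
    (mu : {measure set X -> \bar R}) (D N : set X) (f g : X -> \bar R) :
  measurable N -> mu N = 0%E -> (forall x, D x -> ~ N x -> f x = g x) ->
  (\int[mu]_(x in D) f x = \int[mu]_(x in D) g x)%E.
Proof.
move=> mN N0 fg.
have key (u v : X -> \bar R) : (forall x, (0 <= v x)%E) -> (forall x, ~ N x -> u x = v x) ->
  (ereal_sup [set sintegral mu h | h in [set h : {nnsfun X >-> R} | forall x, ((h x)%:E <= u x)%E]] <=
   ereal_sup [set sintegral mu h | h in [set h : {nnsfun X >-> R} | forall x, ((h x)%:E <= v x)%E]])%E.
  move=> v0 uv; apply: ge_ereal_sup => _ [h hu <-].
  (* Setting a simple function to 0 on N preserves its integral and puts it below v there, since v
     >= 0. *)
  pose h' := proj_nnsfun h (measurableC mN).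
  have h'E x : h' x = h x * \1_(~` N) x by [].
  have -> : sintegral mu h = sintegral mu h'.
    rewrite -!integralT_nnsfun; apply: ae_eq_integral => //.
    - by apply/measurable_EFinP; exact: measurable_funPT.
    - by apply/measurable_EFinP; exact: measurable_funPT.
    exists N; split => // x; apply: contra_notP => Nx _ /=.
    by rewrite mindicE mem_set ?mulr1.
  apply: ereal_sup_ubound; exists h' => // x; rewrite h'E indicE.
  have [Nx|Nx] := pselect (N x).
    by rewrite memNset ?mulr0 //; apply.
  by rewrite mem_set // mulr1 -uv.
have rE x : ~ N x -> (f \_ D) x = (g \_ D) x.
  by move=> Nx; rewrite !patchE; case: ifPn => // /set_mem Dx; exact: fg.
have rE' x : ~ N x -> (g \_ D) x = (f \_ D) x by move=> /rE.
rewrite /integral; congr (_ - _)%E; apply/eqP; rewrite eq_le; apply/andP; split;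
  apply: key => x; rewrite ?funepos_ge0 ?funeneg_ge0 // => Nx.
- by rewrite !funeposE rE.
- by rewrite !funeposE rE.
- by rewrite !funenegE rE.
- by rewrite !funenegE rE.
Qed.

End integral_off_null_set.

#[local] Instance ae_lebesgue_filter (R : realType) :
  Filter (nbhs (almost_everywhere (@lebesgue_measure R))) :=
  ae_filter_ringOfSetsType _.

Lemma derive1_cstD (R : realType) (c : R) (F : R -> R) (t : R) :
  derivable F t 1 -> 'D_1 (fun x => c + F x) t = derive1 F t.
Proof.
move=> dF; rewrite derive1E (_ : (fun x => c + F x) = cst c + F) //.
by rewrite deriveD // derive_cst add0r.
Qed.

Section primitive.
Context {R : realType} {d : nat}.
Variables (T : R) (x0 : 'rV[R]_d).
Hypothesis T0 : 0 < T.
Local Notation mu := (@lebesgue_measure R).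
Implicit Types phi psi : R -> 'rV[R]_d.

Definition mcoord phi : Prop := forall i, measurable_fun setT (fun s => phi s 0 i).

Definition icoord phi : Prop := forall i, mu.-integrable `[0, T] (fun s => (phi s 0 i)%:E).

Definition primitive phi : R -> 'rV[R]_d :=
  fun t => if 0 <= t <= T then x0 + vintegral phi t else 0.

Lemma primitive0 phi : primitive phi 0 = x0.
Proof.
rewrite /primitive lexx (ltW T0) /=; apply/rowP => i; rewrite !mxE.
by rewrite set_itv1 Rintegral_set1 addr0.
Qed.

Lemma derive1_primitive phi : mcoord phi -> icoord phi ->
  {ae mu, forall t, `[0, T]%classic t -> derive1 (primitive phi) t = phi t}.
Proof.
move=> mphi iphi.
pose f i := (fun s => phi s 0 i) \_ `[0, T].
have iT i : mu.-integrable setT (EFin \o f i).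
  by have := iphi i; rewrite integrable_mkcond //= restrict_EFin.
have ftc i : {ae mu, forall t, (0 < t) ->
    derivable (fun y : R => \int[mu]_(s in `[0, y]) f i s) t 1 /\
    derive1 (fun y : R => \int[mu]_(s in `[0, y]) f i s) t = f i t}.
  have h1 y : mu.-integrable [set` Interval (BLeft 0) (BRight y)] (EFin \o f i).
    exact: integrableS (iT i).
  have h2 : locally_integrable setT (f i).
    by apply: open_integrable_locally => //; exact: openT.
  apply: filterS (FTC1 h1 h2) => t h t0; apply: h.
  by rewrite /= lte_fin.
(* The primitive is 0 outside [0, T] and may jump at the two ends; near an interior point it agrees
   with the integrals of the truncated coordinates. *)
have ends : {ae mu, forall t, t != 0 /\ t != T}.
  exists [set 0; T]; split.
  - by apply: measurableU.
  - apply/null_set_setU => //; exact: lebesgue_measure_set1.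
  - move=> t /= /not_andP[|] /negP; rewrite negbK => /eqP ->; by [left|right].
have : {ae mu, forall t, forall i, (0 < t) ->
    derivable (fun y : R => \int[mu]_(s in `[0, y]) f i s) t 1 /\
    derive1 (fun y : R => \int[mu]_(s in `[0, y]) f i s) t = f i t}.
  exact: filter_forall.
apply: filterS2 ends => t [t0 tT] ft; rewrite /= in_itv /= => /andP[t0' tT'].
have tgt0 : 0 < t by rewrite lt_neqAle eq_sym t0.
have tltT : t < T by rewrite lt_neqAle tT.
pose G := fun y => x0 + \row_i \int[mu]_(s in `[0, y]) f i s.
have nearG : {near t, G =1 primitive phi}.
  have : \forall y \near t, y \in `]0, T[.
    by apply: near_in_itvoo; rewrite in_itv /= tgt0.
  apply: filterS => y; rewrite in_itv /= => /andP[y0 yT].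
  rewrite /G /primitive (ltW y0) (ltW yT) /=; congr (_ + _).
  apply/rowP => i; rewrite !mxE; apply: eq_Rintegral => s.
  rewrite inE /= in_itv /= => /andP[s0 sy].
  by rewrite /f patchE mem_set //= in_itv /= s0 (le_trans sy (ltW yT)).
rewrite derive1E -(near_eq_derive _ nearG).
have dG i j : derivable (fun y => G y i j) t 1.
  under eq_fun do rewrite !mxE.
  by apply: derivableD; [exact: derivable_cst|have [] := ft j tgt0].
rewrite derive_mx; last exact/derivable_mxP.
apply/rowP => i; rewrite !mxE; under eq_fun do rewrite !mxE.
have [h1 h2] := ft i tgt0.
rewrite derive1_cstD // h2 /f patchE mem_set //= in_itv /= t0' tT' //.
Qed.

(** Almost everywhere the derivatives occurring in [oplus] are the densities themselves. This turns
    decomposability of L into gluing of densities. *)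
Lemma oplus_primitive phi psi (a : R) : mcoord phi -> icoord phi ->
  mcoord psi -> icoord psi -> 0 <= a <= T ->
  oplus T a (primitive phi) (primitive psi) =
  primitive (fun s => if s < a then phi s else psi s).
Proof.
move=> m1 i1 m2 i2 /andP[a0 aT]; apply/funext => t.
rewrite /oplus primitive0 /primitive; case: ifP => // /andP[t0 tT].
congr (_ + _); apply/rowP => i; rewrite !mxE /Rintegral; congr fine.
have := derive1_primitive m1 i1; have := derive1_primitive m2 i2.
move=> [N2 [mN2 N20 h2]] [N1 [mN1 N10 h1]].
apply: (@integral_off_null_set _ _ _ mu _ (N1 `|` N2)).
- exact: measurableU.
- exact: null_set_setU.
move=> s /=; rewrite in_itv /= => /andP[s0 st] /not_orP[n1 n2].
have sT : `[0, T]%classic s by rewrite /= in_itv /= s0 (le_trans st).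
have e1 : derive1 (primitive phi) s = phi s.
  by apply: contrapT => h; apply: n1; apply: h1 => /= /(_ sT).
have e2 : derive1 (primitive psi) s = psi s.
  by apply: contrapT => h; apply: n2; apply: h2 => /= /(_ sT).
rewrite e1 e2 !indicE; case: ltP => sa.
  rewrite mem_set ?memNset ?scale1r ?scale0r ?addr0 //=.
    by rewrite in_itv /= leNgt sa.
  by rewrite in_itv /= s0.
rewrite memNset ?mem_set ?scale1r ?scale0r ?add0r //=.
  by rewrite in_itv /= sa (le_trans st).
by rewrite in_itv /= ltNge sa andbF.
Qed.

End primitive.

(** * L^p bound on a scalar density *)

Section scalar_density_bound.
Context {R : realType} (T p c V : R) (F v : R -> R).
Hypotheses (T0 : 0 < T) (p1 : 1 <= p).
Local Notation mu := (@lebesgue_measure R).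
Hypothesis mv : measurable_fun setT v.
Hypothesis iv : mu.-integrable `[0, T] (EFin \o v).
Hypothesis FE : forall t, 0 <= t <= T -> F t = c + \int[mu]_(s in `[0, t]) v s.

(** Left end of the dyadic cell containing x. For x < 0 it is x itself, so that the cells shrink
    nicely at every real point. *)
Let corner (n : nat) (x : R) : R :=
  if 0 <= x then grid T n (Num.truncn (x / mesh T n)) else x.
Let cell (x : R) (n : nat) : set R := `[corner n x, corner n x + mesh T n[%classic.

Let corner_itv n x : corner n x <= x < corner n x + mesh T n.
Proof.
have m0 := mesh_gt0 T0 n.
rewrite /corner; case: ifPn => [x0|_]; last by rewrite lexx ltrDl.
have q0 : 0 <= x / mesh T n by rewrite divr_ge0 // ltW.
have /andP[h1 h2] := truncn_itv q0.
rewrite ler_pdivlMr // in h1; rewrite ltr_pdivrMr // in h2.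
by rewrite -gridS h1 h2.
Qed.

Let cvg_mesh : mesh T n @[n --> \oo] --> (0 : R).
Proof.
have h : `|2^-1 : R| < 1 by rewrite ger0_norm // invf_lt1 // ltr1n.
have := @cvg_geometric R T _ h.
by apply: cvg_trans; apply: near_eq_cvg; near=> n; rewrite /geometric /mesh /= exprVn.
Unshelve. all: by end_near. Qed.

Let mu_cell x n : mu (cell x n) = (mesh T n)%:E.
Proof.
rewrite /cell lebesgue_measure_itv /= lte_fin ltrDl mesh_gt0 //.
by rewrite -EFinD addrAC subrr add0r.
Qed.

Let cell_nicely_shrinking x : nicely_shrinking x (cell x).
Proof.
split=> [n|]; first exact: measurable_itv.
(* A ball of radius [mesh T n] is twice as long as the cell. *)
exists (2, fun n => PosNum (mesh_gt0 T0 n)); split => //=.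
- move=> n y; rewrite /cell /= in_itv /= /ball /= => /andP[h1 h2].
  have /andP[h3 h4] := corner_itv n x.
  by rewrite ltr_norml; apply/andP; split; lra.
- move=> n; rewrite mu_cell lebesgue_measure_ball ?(ltW (mesh_gt0 T0 n)) //.
  by rewrite -EFinM lee_fin mulr_natl.
Qed.

Let slope_eq_avg x n : 0 <= x < T ->
  ((mu (cell x n))^-1 * \int[mu]_(y in cell x n) ((v \_ `[0, T]) y)%:E)%E =
  (pstep T n (slope T F n) x)%:E.
Proof.
move=> xT; have m0 := mesh_gt0 T0 n.
have /andP[c1 c2] := corner_itv n x.
have /andP[x0 xT'] := xT.
pose k := Num.truncn (x / mesh T n).
have cE : corner n x = grid T n k by rewrite /corner x0.
have kn : (k < 2 ^ n)%N.
  by rewrite -(ltr_grid T0 n) grid_max -cE (le_lt_trans c1).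
have gk0 : 0 <= grid T n k by rewrite -(grid0 T n) ler_grid.
have gkT : grid T n k.+1 <= T by rewrite -[leRHS](grid_max T n) ler_grid.
rewrite (@pstep_eq _ _ T0 n _ k) //; last by rewrite gridS -cE c1.
have iv' : mu.-integrable `[0, grid T n k.+1] (EFin \o v).
  by apply: integrableS iv => //= y; rewrite /= !in_itv /= => /andP[-> /le_trans]; apply.
have iv'' : mu.-integrable `]grid T n k, grid T n k.+1] (EFin \o v).
  apply: integrableS iv' => //= y; rewrite /= !in_itv /= => /andP[h1 ->].
  by rewrite (le_trans gk0 (ltW h1)).
have -> : (\int[mu]_(y in cell x n) ((v \_ `[0, T]) y)%:E =
    \int[mu]_(y in `]grid T n k, grid T n k.+1]) (v y)%:E)%E.
  rewrite /cell cE -gridS.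
  transitivity (\int[mu]_(y in `[grid T n k, grid T n k.+1[) (v y)%:E)%E.
    apply: eq_integral => y; rewrite inE /= in_itv /= => /andP[h1 h2].
    rewrite patchE mem_set //= in_itv /= (le_trans gk0 h1) (le_trans (ltW h2)) //.
  have mvv (A : set R) : measurable_fun A (fun y => (v y)%:E).
    by apply/measurable_EFinP; exact: measurable_funTS.
  by rewrite integral_itv_bndo_bndc // -integral_itv_obnd_cbnd.
rewrite -[X in (_ * X)%E]fineK; last by apply: integrable_fin_num.
rewrite -/(Rintegral _ _ _) mu_cell inver gt_eqF // -EFinM; congr EFin.
rewrite /slope mulrC; congr (_ / _).
rewrite -(@Rintegral_itvB _ v (BLeft 0)) ?bnd_simp //; last by rewrite ler_grid.
rewrite !FE; first by rewrite opprD addrACA subrr add0r.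
  by rewrite gk0 /= (le_trans _ gkT) // ler_grid.
by rewrite gkT (le_trans gk0) // ler_grid.
Qed.

(** The quotients are the means of v over cells shrinking nicely to t, so Lebesgue's differentiation
    theorem applies. *)
Lemma pstep_slope_cvg : {ae mu, forall t, `[0, T]%classic t ->
  pstep T n (slope T F n) t @[n --> \oo] --> v t}.
Proof.
have lf : locally_integrable setT (v \_ `[0, T]).
  apply: open_integrable_locally; first exact: openT.
  by have := iv; rewrite integrable_mkcond //= restrict_EFin.
have ends : {ae mu, forall t, t != T}.
  exists [set T]; split => //; first exact: lebesgue_measure_set1.
  by move=> t /= /negP; rewrite negbK => /eqP ->.
apply: filterS2 ends (lebesgue_differentiation lf) => t tT lt tI.
have /andP[t0 tT'] : 0 <= t <= T by move: tI; rewrite /= in_itv.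
have tT2 : 0 <= t < T by rewrite t0 lt_neqAle tT.
have := nice_lebesgue_differentiation cell_nicely_shrinking lf lt.
rewrite patchE mem_set // => H.
suff : (fun n => (pstep T n (slope T F n) t)%:E) @ \oo --> (v t)%:E by move/fine_cvgP => [].
by move: H; apply: cvg_trans; apply: near_eq_cvg; near=> n; rewrite slope_eq_avg.
Unshelve. all: by end_near. Qed.

(** Away from 0 the power is differentiable, hence continuous. At l = 0 the bound |u|^p <= |u| for
    |u| <= 1 is used instead. *)
Lemma cvg_normr_powR (u : nat -> R) (l : R) : u @ \oo --> l ->
  (`|u n| `^ p) @[n --> \oo] --> `|l| `^ p.
Proof.
move=> ul; have p0 : p != 0 by rewrite gt_eqF // (lt_le_trans ltr01).
have [l0|l0] := eqVneq l 0.
  move: ul; rewrite {}l0 normr0 powR0 // => /cvgrPdist_lt ul.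
  apply/cvgrPdist_lt => e e0.
  have m0 : 0 < Num.min 1 e by rewrite lt_min ltr01.
  near=> n; have : `|0 - u n| < Num.min 1 e by near: n; exact: ul.
  rewrite !sub0r !normrN lt_min => /andP[u1 ue].
  rewrite ger0_norm ?powR_ge0 //; apply: le_lt_trans ue.
  have [->|un0] := eqVneq (u n) 0; first by rewrite normr0 powR0.
  by rewrite ge1r_powR // normr_gt0 un0 ltW.
have cu : `|u n| @[n --> \oo] --> `|l| by exact: cvg_norm.
have cp : {for `|l|, continuous (fun x : R => x `^ p)}; last first.
  exact: (@continuous_cvg _ _ _ \oo _ (fun n => `|u n|) (fun x : R => x `^ p)).
apply/differentiable_continuous/derivable1_diffP/derivable_powR.
by rewrite in_itv /= andbT normr_gt0.
Unshelve. all: by end_near. Qed.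

Hypothesis hV : forall n,
  \sum_(0 <= k < 2 ^ n) `|slope T F n k| `^ p * mesh T n <= V.

(** Fatou's lemma along the dyadic quotients: their p-th powers integrate to the sums in [hV] and
    converge almost everywhere to |v|^p. *)
Lemma powR_density_bound : (\int[mu]_(t in `[0%R, T]) (`|v t| `^ p)%:E <= V%:E)%E.
Proof.
have p0 : p != 0 by rewrite gt_eqF // (lt_le_trans ltr01).
pose g n t := (`|pstep T n (slope T F n) t| `^ p)%:E.
have mg n : measurable_fun `[0, T]%classic (g n).
  apply/measurable_EFinP; apply: (@measurableT_comp _ _ _ _ _ _ (fun x : R => x `^ p)).
    exact: measurable_powR.
  by apply: measurableT_comp => //; apply: measurable_funTS; exact: measurable_pstep.
have mvp : measurable_fun `[0, T]%classic (fun t => (`|v t| `^ p)%:E).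
  apply/measurable_EFinP; apply: (@measurableT_comp _ _ _ _ _ _ (fun x : R => x `^ p)).
    exact: measurable_powR.
  by apply: measurableT_comp => //; exact: measurable_funTS.
have -> : (\int[mu]_(t in `[0%R, T]) (`|v t| `^ p)%:E =
    \int[mu]_(t in `[0%R, T]) limn_einf (g ^~ t))%E.
  have [N [mN N0 hN]] := pstep_slope_cvg.
  apply: (integral_off_null_set mN N0) => t tT Nt.
  have h : pstep T n (slope T F n) t @[n --> \oo] --> v t.
    by apply: contrapT => nh; apply: Nt; apply: hN => /= /(_ tT).
  have cE : (fun n => g n t) @ \oo --> (`|v t| `^ p)%:E.
    by apply/fine_cvgP; split; [exact: nearW|exact: cvg_normr_powR].
  by rewrite (cvg_limn_einf_sup cE).1.
have g0 n t : `[0, T]%classic t -> (0 <= g n t)%E by rewrite lee_fin powR_ge0.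
apply: (le_trans (fatou mu (measurable_itv `[0, T]) mg g0)).
have bd n : (\int[mu]_(t in `[0%R, T]) g n t <= V%:E)%E.
  have gE t : g n t = (pstep T n (fun k => `|slope T F n k| `^ p) t)%:E.
    rewrite /g; case: (pstep_cases T0 n t) => [h|[k kn hk]].
      by rewrite !pstep_out // normr0 powR0.
    by rewrite !hk.
  under eq_integral do rewrite gE.
  rewrite -[leLHS]fineK; last by apply: integrable_fin_num => //; exact: integrable_pstep.
  by rewrite -/(Rintegral _ _ _) lee_fin -{1}(grid_max T n) Rintegral_pstep.
rewrite limn_einf_lim; apply: lime_le; first exact: is_cvg_einfs.
apply: nearW => n; apply: le_trans (bd n).
by apply: ereal_inf_lbound; exists n => /=.
Qed.

End scalar_density_bound.

(** * Integrability of real-valued functions *)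

Section integrable_real.
Context d (X : measurableType d) (R : realType) (mu : {measure set X -> \bar R}).
Variables (A : set X) (mA : measurable A).
Implicit Types f g : X -> R.

Lemma integrable_realD f g : mu.-integrable A (fun x => (f x)%:E) ->
  mu.-integrable A (fun x => (g x)%:E) -> mu.-integrable A (fun x => (f x + g x)%:E).
Proof.
move=> hf hg; rewrite (_ : (fun x => _) = (fun x => (f x)%:E) \+ (fun x => (g x)%:E))%E.
  exact: integrableD.
by apply/funext => x; rewrite EFinD.
Qed.

Lemma integrable_realZ (c : R) f : mu.-integrable A (fun x => (f x)%:E) ->
  mu.-integrable A (fun x => (c * f x)%:E).
Proof.
move=> hf; rewrite (_ : (fun x => _) = (fun x => c%:E * (f x)%:E)%E).
  exact: integrableZl.
by apply/funext => x; rewrite EFinM.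
Qed.

Lemma integrable_realB f g : mu.-integrable A (fun x => (f x)%:E) ->
  mu.-integrable A (fun x => (g x)%:E) -> mu.-integrable A (fun x => (f x - g x)%:E).
Proof.
move=> hf hg; under eq_fun do rewrite -mulN1r.
by apply: integrable_realD => //; exact: integrable_realZ.
Qed.

Lemma integrable_real_sum (I : finType) (F : I -> X -> R) :
  (forall i, mu.-integrable A (fun x => (F i x)%:E)) ->
  mu.-integrable A (fun x => (\sum_i F i x)%:E).
Proof.
move=> hF; rewrite (_ : (fun x => _) = (fun x => (\sum_i (F i x)%:E)%E)).
  by apply: integrable_sum => // i _; exact: hF.
by apply/funext => x; rewrite sumEFin.
Qed.

Lemma integrable_real_norm f : mu.-integrable A (fun x => (f x)%:E) ->
  mu.-integrable A (fun x => `|f x|%:E).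
Proof. by move=> hf; have := integrable_abse hf. Qed.

Lemma integrable_real_le f g : measurable_fun A f ->
  (forall x, A x -> `|f x| <= g x) -> mu.-integrable A (fun x => (g x)%:E) ->
  mu.-integrable A (fun x => (f x)%:E).
Proof.
move=> mf fg; apply: le_integrable => //; first exact/measurable_EFinP.
by move=> x Ax /=; rewrite lee_fin (le_trans (fg x Ax)) // ler_norm.
Qed.

Lemma Rintegral_sum (I : finType) (F : I -> X -> R) :
  (forall i, mu.-integrable A (fun x => (F i x)%:E)) ->
  \int[mu]_(x in A) (\sum_i F i x) = \sum_i \int[mu]_(x in A) F i x.
Proof.
move=> hF; rewrite /Rintegral; under eq_integral do rewrite -sumEFin.
rewrite integral_sum // -?sum_fine //.
by move=> i _; exact: integrable_fin_num.
Qed.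

End integrable_real.

Lemma Rintegral_itv0B (R : realType) (v : R -> R) (a b : R) : 0 <= a -> a <= b ->
  (@lebesgue_measure R).-integrable `[0, b] (EFin \o v) ->
  \int[@lebesgue_measure R]_(s in `[0, b]) v s - \int[@lebesgue_measure R]_(s in `[0, a]) v s =
  \int[@lebesgue_measure R]_(s in `]a, b]) v s.
Proof. by move=> a0 ab iv; rewrite Rintegral_itvB ?bnd_simp. Qed.

Lemma integrable_cst_itv (R : realType) (b0 b1 : bool) (a b c : R) :
  (@lebesgue_measure R).-integrable [set` Interval (BSide b0 a) (BSide b1 b)] (EFin \o cst c).
Proof.
apply: measurable_bounded_integrable => //; last exact: bounded_cst.
by rewrite /= lebesgue_measure_itv /=; case: ifP => _; rewrite -?EFinD ltry.
Qed.

(** * Primitives of p-integrable functions have finite Riesz variation *)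

Section primitive_in_BVp.
Context {R : realType} {d : nat}.
Variables (T p : R) (x0 : 'rV[R]_d) (phi : R -> 'rV[R]_d).
Hypotheses (T0 : 0 < T) (p1 : 1 <= p).
Local Notation mu := (@lebesgue_measure R).
Hypotheses (mphi : mcoord phi) (iphi : icoord T phi).
Hypothesis ipphi : mu.-integrable `[0, T] (fun s => (norm1 (phi s) `^ p)%:E).

Let f := primitive T x0 phi.

Lemma integrable_norm1 : mu.-integrable `[0, T] (fun s => (norm1 (phi s))%:E).
Proof.
by apply: integrable_real_sum => // i; apply: integrable_real_norm => //; exact: iphi.
Qed.

Let G s := norm1 (phi s) `^ p + 1.

Let iG : mu.-integrable `[0, T] (EFin \o G).
Proof.
by apply: integrable_realD => //; exact: (integrable_cst_itv _ _ 0 T 1).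
Qed.

(** A crude Young inequality: replace the smaller of x and m by the larger. *)
Lemma mulr_powRB1_le (x m : R) : 0 <= x -> 0 <= m ->
  x * m `^ (p - 1) <= x `^ p + m `^ p.
Proof.
move=> x_ge0 m_ge0; have p0 : 0 < p := lt_le_trans ltr01 p1.
have q0 : 0 <= p - 1 by rewrite subr_ge0.
case: (leP x m) => xm.
  rewrite ler_wpDl ?powR_ge0 // -(mulr_powRB1 m_ge0 p0).
  by rewrite ler_wpM2r ?powR_ge0.
rewrite ler_wpDr ?powR_ge0 // -[leRHS](mulr_powRB1 x_ge0 p0).
by rewrite ler_wpM2l // ge0_ler_powR ?nnegrE // ltW.
Qed.

Let sub_itv a b : 0 <= a -> b <= T -> `]a, b]%classic `<=` `[0, T]%classic.
Proof.
move=> a0 bT s; rewrite /= !in_itv /= => /andP[h1 h2].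
by rewrite (le_trans a0 (ltW h1)) (le_trans h2).
Qed.

Lemma primitive_sub_norm1 a b : 0 <= a -> a <= b -> b <= T ->
  norm1 (f b - f a) <= \int[mu]_(s in `]a, b]) norm1 (phi s).
Proof.
move=> a0 ab bT.
have sab := sub_itv a0 bT.
rewrite /f /primitive a0 bT (le_trans a0 ab) (le_trans ab bT) /=.
rewrite opprD addrACA subrr add0r /norm1.
have iab i : mu.-integrable `]a, b] (fun s => (phi s 0 i)%:E).
  exact: integrableS (iphi i).
apply: (@le_trans _ _ (\sum_i \int[mu]_(s in `]a, b]) `|phi s 0 i|)).
  apply: ler_sum => i _; rewrite !mxE.
  rewrite (Rintegral_itv0B a0 ab).
    exact: (@le_normr_Rintegral _ _ _ mu _ (fun s => phi s 0 i) (measurable_itv `]a, b]) (iab i)).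
  apply: integrableS (iphi i) => // s; rewrite /= !in_itv /= => /andP[-> h].
  exact: le_trans bT.
rewrite Rintegral_sum // => i.
by apply: integrable_real_norm => //; exact: iab.
Qed.

(** This is Hölder's inequality with a worse constant. Let J be the integral of G and m^p = J / (b -
    a). Integrating [mulr_powRB1_le] gives I m^(p-1) <= 2J = 2 m^p (b - a), hence I <= 2m (b - a),
    and the p-th power yields 2^p J (b - a)^(p-1). The summand 1 in G makes J positive, so that m
    can be cancelled. *)
Lemma riesz_term_primitive a b : 0 <= a -> a < b -> b <= T ->
  riesz_term p f a b <= 2 `^ p * \int[mu]_(s in `]a, b]) G s.
Proof.
move=> a0 ab bT; have p0 : 0 < p := lt_le_trans ltr01 p1.
have sab := sub_itv a0 bT.
have ba0 : 0 < b - a by rewrite subr_gt0.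
set J := Rintegral _ _ _; set I := \int[mu]_(s in `]a, b]) norm1 (phi s).
have iGab : mu.-integrable `]a, b] (EFin \o G) by exact: integrableS iG.
have inab : mu.-integrable `]a, b] (fun s => (norm1 (phi s))%:E).
  exact: integrableS integrable_norm1.
have ipab : mu.-integrable `]a, b] (fun s => (norm1 (phi s) `^ p)%:E).
  exact: integrableS ipphi.
have muab (r : R) : \int[mu]_(s in `]a, b]) r = r * (b - a).
  by rewrite Rintegral_cst //= lebesgue_measure_itv /= lte_fin ab.
have icst (c : R) : mu.-integrable `]a, b] (EFin \o cst c).
  exact: integrable_cst_itv.
have JE : J = \int[mu]_(s in `]a, b]) (norm1 (phi s) `^ p) + (b - a).
  rewrite /J /G RintegralD //; last exact: (icst 1).
  by rewrite muab mul1r.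
have P0 : 0 <= \int[mu]_(s in `]a, b]) (norm1 (phi s) `^ p).
  by apply: Rintegral_ge0 => s _; exact: powR_ge0.
have J0 : 0 < J by rewrite JE ltr_wpDl.
pose m := (J / (b - a)) `^ p^-1.
have m0 : 0 < m by rewrite powR_gt0 // divr_gt0.
have mp : m `^ p = J / (b - a).
  by rewrite /m -powRrM mulVf ?gt_eqF // powRr1 // divr_ge0 // ltW.
have I0 : 0 <= I by apply: Rintegral_ge0 => s _; exact: norm1_ge0.
have Im : I * m `^ (p - 1) <= 2 * J.
  rewrite mulrC /I -RintegralZl //.
  apply: (@le_trans _ _ (\int[mu]_(s in `]a, b]) (norm1 (phi s) `^ p + m `^ p))).
    apply: le_Rintegral => //.
    - exact: integrable_realZ.
    - by apply: integrable_realD => //; exact: (icst (m `^ p)).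
    - by move=> s _; rewrite mulrC; apply: mulr_powRB1_le; [exact: norm1_ge0|exact: ltW].
  rewrite RintegralD //; last exact: (icst (m `^ p)).
  rewrite muab mp divfK ?gt_eqF //.
  by rewrite mulr_natl mulr2n lerD2r JE lerDl ltW.
have Im2 : I <= 2 * m * (b - a).
  rewrite -(ler_pM2r (powR_gt0 (p - 1) m0)); apply: le_trans Im _.
  have -> : 2 * m * (b - a) * m `^ (p - 1) = 2 * (b - a) * (m * m `^ (p - 1)).
    by ring.
  by rewrite mulr_powRB1 ?(ltW m0) // mp -mulrA (mulrC (b - a)) divfK ?gt_eqF.
rewrite /riesz_term ler_pdivrMr ?powR_gt0 //.
apply: (@le_trans _ _ ((2 * m * (b - a)) `^ p)).
  rewrite ge0_ler_powR ?nnegrE ?enorm_ge0 ?(ltW p0) //.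
    by rewrite !mulr_ge0 // ltW.
  apply: le_trans (enorm_le_norm1 _) _.
  by apply: le_trans (primitive_sub_norm1 a0 (ltW ab) bT) _.
rewrite !powRM ?mulr_ge0 ?(ltW m0) ?(ltW ba0) // mp -(mulr_powRB1 (ltW ba0) p0).
by rewrite !mulrA -[2 `^ p * J / _ * _]mulrA mulVf ?mulr1 // gt_eqF.
Qed.

(** The bound of [riesz_term_primitive] is an increment of H, so Riesz sums telescope. *)
Lemma primitive_BVp : BVp T p f.
Proof.
split=> [t|].
  by rewrite /= in_itv /= /f /primitive; case: ifP => // _ [].
suff : (riesz_variation T p f <= (2 `^ p * \int[mu]_(s in `[0, T]) G s)%:E)%E.
  by move=> /le_lt_trans; apply; rewrite ltry.
apply/riesz_variation_bound => s [sp /eqP sl].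
pose H t := 2 `^ p * \int[mu]_(s in `[0, t]) G s.
have step a b : 0 <= a -> a < b -> b <= T -> riesz_term p f a b <= H b - H a.
  move=> a0 ab bT; rewrite /H -mulrBr (Rintegral_itv0B a0 (ltW ab)).
    exact: riesz_term_primitive.
  apply: integrableS iG => // t; rewrite /= !in_itv /= => /andP[-> h].
  exact: le_trans bT.
(* The left end is arbitrary so that the induction on the partition goes through. *)
have key a : 0 <= a -> path <%O a s -> last a s = T ->
    \sum_(0 <= i < size s) riesz_term p f (nth 0 (a :: s) i) (nth 0 (a :: s) i.+1)
    <= H T - H a.
  elim: s a {sp sl} => [|b s IH] a a0 /= sp sl.
    by rewrite big_geq // sl subrr.
  move/andP: sp => [ab sp].
  have b0 : 0 <= b by rewrite (le_trans a0) // ltW.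
  have bT : b <= T.
    rewrite -sl; move: sp; rewrite lt_path_sortedE => /andP[/allP h _].
    by have := mem_last b s; rewrite inE => /predU1P[->//|/h /ltW].
  rewrite [leLHS](sum_consecutive_cons (riesz_term p f) a b s).
  have := step a b a0 ab bT; have := IH b b0 sp sl; lra.
apply: (le_trans (key 0 _ sp sl)) => //.
by rewrite /H set_itv1 Rintegral_set1 mulr0 subr0.
Qed.

End primitive_in_BVp.

(** * Calculus and gluing of vector-valued functions *)

Section coordinates.
Context {R : realType} {d : nat}.
Variables (T p : R) (x0 : 'rV[R]_d).
Hypotheses (T0 : 0 < T) (p1 : 1 <= p).
Local Notation mu := (@lebesgue_measure R).
Implicit Types phi psi : R -> 'rV[R]_d.

Lemma mcoordD phi psi : mcoord phi -> mcoord psi -> mcoord (fun s => phi s + psi s).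
Proof.
move=> h1 h2 i; under eq_fun do rewrite mxE.
exact: measurable_funD.
Qed.

Lemma mcoordZ (h : R -> R) phi : measurable_fun setT h -> mcoord phi ->
  mcoord (fun s => h s *: phi s).
Proof.
move=> hh h1 i; under eq_fun do rewrite mxE.
exact: measurable_funM.
Qed.

Lemma mcoordB phi psi : mcoord phi -> mcoord psi -> mcoord (fun s => phi s - psi s).
Proof.
move=> h1 h2 i; under eq_fun do rewrite !mxE.
exact: measurable_funB.
Qed.

Lemma icoordB phi psi : icoord T phi -> icoord T psi -> icoord T (fun s => phi s - psi s).
Proof.
move=> i1 i2 i; rewrite (_ : (fun s => _) = (fun s => (phi s 0 i - psi s 0 i)%:E)).
  by apply: integrable_realB.
by apply/funext => s; rewrite !mxE.
Qed.

Lemma icoordD phi psi : icoord T phi -> icoord T psi -> icoord T (fun s => phi s + psi s).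
Proof.
move=> i1 i2 i; rewrite (_ : (fun s => _) = (fun s => (phi s 0 i + psi s 0 i)%:E)).
  by apply: integrable_realD.
by apply/funext => s; rewrite !mxE.
Qed.

Lemma icoordZ (c : R) phi : icoord T phi -> icoord T (fun s => c *: phi s).
Proof.
move=> i1 i; rewrite (_ : (fun s => _) = (fun s => (c * phi s 0 i)%:E)).
  by apply: integrable_realZ => //; exact: i1.
by apply/funext => s; rewrite !mxE.
Qed.

Lemma measurable_norm1 phi : mcoord phi -> measurable_fun setT (fun s => norm1 (phi s)).
Proof.
by move=> h; apply: measurable_sum => i; apply: measurableT_comp => //; exact: h.
Qed.

Lemma icoord_norm1 phi : mcoord phi ->
  mu.-integrable `[0, T] (fun s => (norm1 (phi s))%:E) -> icoord T phi.
Proof.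
move=> mphi iphi i; apply: (integrable_real_le _ _ _ iphi) => //.
  exact: (measurable_funTS (mphi i)).
by move=> s _; exact: coord_le_norm1.
Qed.

Definition mix (A : set R) phi psi : R -> 'rV[R]_d :=
  fun s => if s \in A then phi s else psi s.

Lemma mcoord_mix A phi psi : measurable A -> mcoord phi -> mcoord psi ->
  mcoord (mix A phi psi).
Proof.
move=> mA mphi mpsi.
rewrite (_ : mix A phi psi = fun s => \1_A s *: phi s + \1_(~` A) s *: psi s).
  by apply: mcoordD; apply: mcoordZ => //; apply: measurable_indic => //; exact: measurableC.
apply/funext => s; rewrite /mix !indicE in_setC.
by case: (s \in A); rewrite ?scale1r ?scale0r ?addr0 ?add0r.
Qed.

(** K is left general to cover both [norm1] and its p-th power. *)
Lemma integrable_mix (K : 'rV[R]_d -> R) A phi psi : measurable A ->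
  (forall x, 0 <= K x) ->
  (forall chi, mcoord chi -> measurable_fun setT (fun s => K (chi s))) ->
  mcoord phi -> mcoord psi ->
  mu.-integrable `[0, T] (fun s => (K (phi s))%:E) ->
  mu.-integrable `[0, T] (fun s => (K (psi s))%:E) ->
  mu.-integrable `[0, T] (fun s => (K (mix A phi psi s))%:E).
Proof.
move=> mA K0 mK mphi mpsi i1 i2.
have iD : mu.-integrable `[0, T] (fun s => (K (phi s) + K (psi s))%:E).
  exact: integrable_realD.
apply: (integrable_real_le _ _ _ iD) => //.
  by apply: measurable_funTS; apply: mK; exact: mcoord_mix.
move=> s _; rewrite ger0_norm // /mix; case: ifP => _.
  by rewrite lerDl.
by rewrite lerDr.
Qed.

(** The norm is at most d times the largest coordinate, whose p-th power is one of the summands. *)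
Lemma norm1_powR_le (x : 'rV[R]_d) : (0 < d)%N ->
  norm1 x `^ p <= d%:R `^ p * \sum_i `|x 0 i| `^ p.
Proof.
move=> d0; have p0 : 0 <= p := le_trans ler01 p1.
pose i0 := [arg max_(i > Ordinal d0) `|x 0 i|]%O.
have hi j : `|x 0 j| <= `|x 0 i0|.
  by rewrite /i0; case: arg_maxP => // i _; apply.
apply: (@le_trans _ _ ((d%:R * `|x 0 i0|) `^ p)).
  rewrite ge0_ler_powR ?nnegrE ?norm1_ge0 ?mulr_ge0 ?ler0n //.
  apply: (@le_trans _ _ (\sum_(i < d) `|x 0 i0|)); first exact: ler_sum.
  by rewrite sumr_const card_ord mulr_natl.
rewrite powRM // ler_wpM2l ?powR_ge0 // (bigD1 i0) //= lerDl.
by apply: sumr_ge0 => j _; exact: powR_ge0.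
Qed.

Lemma norm1_vintegralB phi psi t : icoord T phi -> icoord T psi -> 0 <= t <= T ->
  norm1 (vintegral phi t - vintegral psi t) <=
  \int[mu]_(s in `[0, T]) norm1 (phi s - psi s).
Proof.
move=> i1 i2 /andP[t0 tT].
have sub : `[0, t]%classic `<=` `[0, T]%classic.
  by move=> s; rewrite /= !in_itv /= => /andP[-> /le_trans]; apply.
have iB i : mu.-integrable `[0, T] (fun s => ((phi s - psi s) 0 i)%:E).
  exact: icoordB.
have iBn i : mu.-integrable `[0, T] (fun s => `|(phi s - psi s) 0 i|%:E).
  by apply: integrable_real_norm => //; exact: iB.
rewrite /norm1 Rintegral_sum //; apply: ler_sum => i _; rewrite !mxE.
have it phi' : icoord T phi' -> mu.-integrable `[0, t] (EFin \o (fun s => phi' s 0 i)).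
  by move=> h; apply: integrableS (h i).
rewrite -RintegralB; [|by []|exact: it|exact: it].
apply: (@le_trans _ _ (\int[mu]_(s in `[0, t]) `|(phi s - psi s) 0 i|)).
  have -> : \int[mu]_(s in `[0, t]) (phi s 0 i - psi s 0 i) =
      \int[mu]_(s in `[0, t]) ((phi s - psi s) 0 i).
    by apply: eq_Rintegral => s _; rewrite !mxE.
  apply: (@le_normr_Rintegral _ _ _ mu _ (fun s => (phi s - psi s) 0 i)) => //.
  exact: integrableS (iB i).
rewrite /Rintegral fine_le //.
- by apply: integrable_fin_num => //; apply: integrableS (iBn i).
- by apply: integrable_fin_num => //; exact: iBn.
- apply: ge0_subset_integral => //.
  by have /integrableP[] := iBn i.
Qed.

Lemma eq_primitive phi psi : (forall s, 0 <= s <= T -> phi s = psi s) ->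
  primitive T x0 phi = primitive T x0 psi.
Proof.
move=> h; apply/funext => t; rewrite /primitive; case: ifP => // /andP[t0 tT].
congr (_ + _); apply/rowP => i; rewrite !mxE; apply: eq_Rintegral => s.
by rewrite inE /= in_itv /= => /andP[s0 st]; rewrite h // s0 (le_trans st).
Qed.

End coordinates.

Lemma ae_forall_count (R : realType) (Q : countType) (P : Q -> R -> Prop) :
  (forall q, {ae @lebesgue_measure R, forall s, P q s}) ->
  {ae @lebesgue_measure R, forall s, forall q, P q s}.
Proof.
move=> hP.
have : {ae @lebesgue_measure R, forall s, forall n : nat,
    if unpickle n is Some q then P q s else True}.
  apply: ae_foralln => n; case: unpickle => [q|]; first exact: hP.
  exact: aeW.
by apply: filterS => s h q; have := h (pickle q); rewrite pickleK.
Qed.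

Lemma measurable_lt_set (R : realType) (u v : R -> R) :
  measurable_fun setT u -> measurable_fun setT v ->
  measurable [set s | u s < v s].
Proof.
move=> mu' mv'.
have h : measurable_fun setT (fun s => u s < v s) := measurable_fun_ltr mu' mv'.
by have := h measurableT [set true] Logic.I; rewrite setTI.
Qed.

Section rational_vectors.
Context {R : realType} {d : nat}.

Definition rat_row (q : 'rV[rat]_d) : 'rV[R]_d := \row_i ratr (q 0 i).

Lemma rat_row_dense (x : 'rV[R]_d) (e : R) : 0 < e ->
  exists q, norm1 (x - rat_row q) < e.
Proof.
(* Dividing by d + 1 keeps the final inequality strict and covers d = 0. *)
move=> e0; pose e' := e / d.+1%:R.
have e'0 : 0 < e' by rewrite divr_gt0.
have /choice[q hq] : forall i, exists r : rat, `|x 0 i - ratr r| < e'.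
  move=> i; have [r] := @rat_in_itvoo R (x 0 i - e') (x 0 i + e') (ltac:(by lra)).
  rewrite in_itv /= => /andP[h1 h2]; exists r.
  by rewrite ltr_norml; apply/andP; split; lra.
exists (\row_i q i).
apply: (@le_lt_trans _ _ (\sum_(i < d) e')).
  by apply: ler_sum => i _; rewrite !mxE ltW.
rewrite sumr_const card_ord -mulr_natr /e' -mulrA mulrC -ltr_pdivlMr //.
rewrite divff ?gt_eqF // mulrC ltr_pdivrMr ?ltr0n // mul1r ltr_nat //.
Qed.

End rational_vectors.

(** * Closure of a pointwise bounded sequence *)

Section norm1_topology.
Context {R : realType} {d : nat}.
Implicit Types x y : 'rV[R]_d.

Lemma normr_le_norm1 x : `|x| <= norm1 x.
Proof.
rewrite [leLHS]/Num.Def.normr /= mx_normrE; apply: bigmax_le; first exact: norm1_ge0.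
by move=> [i j] _ /=; rewrite (ord1 i); exact: coord_le_norm1.
Qed.

Lemma norm1_le_normr x : norm1 x <= d%:R * `|x|.
Proof.
apply: (@le_trans _ _ (\sum_(i < d) `|x|)); last first.
  by rewrite sumr_const card_ord mulr_natl.
apply: ler_sum => i _; rewrite [leRHS]/Num.Def.normr /= mx_normrE.
exact: (le_bigmax _ (fun ij : 'I_1 * 'I_d => `|x ij.1 ij.2|) (ord0, i)).
Qed.

Definition adherent_points (g : nat -> 'rV[R]_d) : set 'rV[R]_d :=
  [set x | forall e : R, 0 < e -> exists n, norm1 (x - g n) < e].

Lemma adherent_points_self g n : adherent_points g (g n).
Proof. by move=> e e0; exists n; rewrite subrr norm1_0. Qed.

Lemma adherent_points_approx g x : (forall e : R, 0 < e ->
  exists2 y, adherent_points g y & norm1 (x - y) < e) -> adherent_points g x.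
Proof.
move=> h e e0; have e20 : 0 < e / 2 by rewrite divr_gt0.
have [y /(_ _ e20)[n hn] xy] := h _ e20.
exists n; apply: le_lt_trans (norm1_dist_triangle _ y _) _; lra.
Qed.

Lemma closed_adherent_points g : closed (adherent_points g).
Proof.
move=> x xcl; apply: adherent_points_approx => e e0.
have e'0 : 0 < e / d.+1%:R by rewrite divr_gt0.
have [y [gy xy]] := xcl _ (nbhsx_ballx x _ e'0).
exists y => //; move: xy; rewrite -ball_normE /= => xy.
apply: le_lt_trans (norm1_le_normr _) _.
apply: (@le_lt_trans _ _ (d%:R * (e / d.+1%:R))).
  by rewrite ler_wpM2l // ltW.
by rewrite mulrCA gtr_pMr // ltr_pdivrMr // mul1r ltr_nat.
Qed.

Lemma adherent_points_norm1_le g (M : R) x : (forall n, norm1 (g n) <= M) ->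
  adherent_points g x -> norm1 x <= M.
Proof.
move=> hM gx; apply/ler_addgt0Pr => e e0; have [n hn] := gx e e0.
have := norm1_triangle (x - g n) (g n); rewrite subrK; have := hM n; lra.
Qed.

Lemma compact_adherent_points g (M : R) : (forall n, norm1 (g n) <= M) ->
  compact (adherent_points g).
Proof.
move=> hM; apply: bounded_closed_compact; last exact: closed_adherent_points.
exists M; split; first exact: num_real.
move=> y My x gx; rewrite /= (le_trans (normr_le_norm1 x)) //.
by rewrite (le_trans (adherent_points_norm1_le hM gx)) // ltW.
Qed.

(** The chosen g (n k) lie in a compact set, and a cluster point of them belongs to the closed set
    K. This replaces a search through K by countably many conditions, as measurability requires. *)
Lemma adherent_points_meet g (M : R) (K : set 'rV[R]_d) : (forall n, norm1 (g n) <= M) ->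
  closed K ->
  (forall k : nat, exists n, exists2 y, K y & norm1 (y - g n) < k.+1%:R^-1) ->
  adherent_points g `&` K !=set0.
Proof.
move=> hM cK /choice[n hn].
pose z k := g (n k).
have zg : (z @ \oo) (adherent_points g).
  by exists 0%N => // k _; exact: adherent_points_self.
have [x [gx xcl]] := compact_adherent_points hM _ zg.
exists x; split => //; apply: cK => B /nbhs_ballP[e /= e0 hB].
have e20 : 0 < e / 2 by rewrite divr_gt0.
pose N := Num.truncn (e / 2)^-1.
have : (z @ \oo) [set w | exists2 y, K y & norm1 (y - w) < e / 2].
  exists N => // k /= Nk; have [y Ky hy] := hn k; exists y => //.
  apply: lt_le_trans hy _.
  rewrite -[leRHS]invrK lef_pV2 ?posrE ?invr_gt0 //.
  by rewrite ltW // (lt_le_trans (truncnS_gt _)) // ler_nat ltnS.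
move=> /xcl /(_ (nbhsx_ballx x _ e20))[w [[y Ky hy] xw]].
exists y; split => //; apply: hB.
move: xw; rewrite -!ball_normE /= => xw.
have := ler_distD w x y; have := normr_le_norm1 (y - w).
rewrite (distrC w y); lra.
Qed.

(** A convex combination of densities is known to be adherent only off a null set that depends on
    the coefficient, so the hypothesis is confined to rational ones. For a fixed rational
    coefficient x and y are approximated by terms of g; then the real coefficient is
    approximated. *)
Lemma convex_adherent_points g :
  (forall n m (q : rat), 0 <= (ratr q : R) <= 1 ->
    adherent_points g (ratr q *: g n + (1 - ratr q) *: g m)) ->
  convex_set (adherent_points g).
Proof.
move=> hq x y lam /set_mem gx /set_mem gy; apply/mem_set.
have l0 : 0 <= lam%:num by [].
have l1 : lam%:num <= 1 by [].
rewrite (_ : conv lam x y = lam%:num *: (x : 'rV[R]_d) + (1 - lam%:num) *: (y : 'rV[R]_d)) //.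
move: (lam%:num) l0 l1 => c c0 c1.
apply: adherent_points_approx => e e0.
pose K := norm1 x + norm1 y + 1.
have K0 : 0 < K by rewrite ltr_wpDl // addr_ge0 // norm1_ge0.
have [q qc q01] : exists2 q : rat, `|c - ratr q| < e / 2 / K & 0 <= (ratr q : R) <= 1.
  have h0 : 0 < e / 2 / K by rewrite !divr_gt0.
  (* Clipping to [0, 1] keeps the rational coefficient admissible. *)
  pose a := Num.max 0 (c - e / 2 / K); pose b := Num.min 1 (c + e / 2 / K).
  have ab : a < b by rewrite gt_max !lt_min; lra.
  have [q] := rat_in_itvoo ab.
  rewrite in_itv /= gt_max lt_min => /andP[/andP[q0 q1] /andP[q2 q3]].
  exists q; last by rewrite ltW // ltW.
  by rewrite ltr_norml; apply/andP; split; lra.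
have /andP[q0 q1] := q01.
have e20 : 0 < e / 2 by rewrite divr_gt0.
pose r : R := ratr q.
have lim2 : adherent_points g (r *: x + (1 - r) *: y).
  apply: adherent_points_approx => e' e'0.
  have e'20 : 0 < e' / 2 by rewrite divr_gt0.
  have [n hn] := gx _ e'20; have [m hm] := gy _ e'20.
  exists (r *: g n + (1 - r) *: g m); first exact: hq.
  have -> : r *: x + (1 - r) *: y - (r *: g n + (1 - r) *: g m) =
      r *: (x - g n) + (1 - r) *: (y - g m).
    by apply/rowP => i; rewrite !mxE; ring.
  apply: le_lt_trans (norm1_triangle _ _) _; rewrite !norm1Z.
  have r0 : 0 <= r := q0; have r1 : 0 <= 1 - r by rewrite subr_ge0.
  rewrite !ger0_norm //; have := norm1_ge0 (x - g n); have := norm1_ge0 (y - g m).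
  nra.
exists (r *: x + (1 - r) *: y) => //.
have -> : c *: x + (1 - c) *: y - (r *: x + (1 - r) *: y) = (c - r) *: (x - y).
  by apply/rowP => i; rewrite !mxE; ring.
rewrite norm1Z; apply: (@le_lt_trans _ _ (e / 2 / K * K)).
  apply: ler_pM => //; [exact: norm1_ge0|exact: ltW|].
  by rewrite (le_trans (norm1_triangle _ _)) // norm1N /K lerDl.
rewrite divfK ?gt_eqF //; lra.
Qed.

End norm1_topology.

(** * The multifunction generated by a sequence *)

Section castaing.
Context {R : realType} {d : nat}.
Variables (T : R) (g : nat -> R -> 'rV[R]_d) (N : set R) (H : R -> R).
Local Notation mu := (@lebesgue_measure R).
Hypotheses (mN : measurable N) (mg : forall n, mcoord (g n)).
Hypothesis gH : forall s, `[0, T]%classic s -> ~ N s -> forall n, norm1 (g n s) <= H s.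
Hypothesis gconv : forall s, `[0, T]%classic s -> ~ N s ->
  forall n m (q : rat), 0 <= (ratr q : R) <= 1 ->
    adherent_points (g ^~ s) (ratr q *: g n s + (1 - ratr q) *: g m s).

(* The value on the null set N only has to lie in Conv and be measurable. *)
Definition castaing (s : R) : set 'rV[R]_d :=
  if s \in N then [set 0] else adherent_points (g ^~ s).

Lemma castaing_Conv s : `[0, T]%classic s -> Conv (castaing s).
Proof.
move=> sT; rewrite /castaing; case: ifPn => [_|/negP].
  split; first by exists 0.
    exact: compact_set1.
  move=> x y c /set_mem -> /set_mem ->; apply/mem_set.
  by rewrite /conv /= !scaler0 addr0.
rewrite inE => sN; split.
- by exists (g 0%N s); exact: (adherent_points_self (g ^~ s)).
- exact: (compact_adherent_points (gH sT sN)).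
- by apply: convex_adherent_points => n m q q01; exact: gconv.
Qed.

Lemma measurable_norm1_lt n (q : 'rV[R]_d) (e : R) :
  measurable [set s | norm1 (g n s - q) < e].
Proof.
apply: measurable_lt_set => //.
apply: (measurable_norm1 (phi := fun s => g n s - q)).
exact: (mcoordB (mg n) (psi := cst q)).
Qed.

(** Off N, the value meets K exactly when for each k some rational vector is 1/(k+1)-close both to K
    and to some g n s. Closeness to K does not involve s, so E is built from measurable sets by
    countable operations. *)
Lemma castaing_measurable : measurable_multifun T castaing.
Proof.
move=> K cK.
pose near_K k (q : 'rV[rat]_d) := exists2 y, K y & norm1 (y - rat_row q) < k.+1%:R^-1.
pose E := \bigcap_(k : nat) \bigcup_(q in near_K k) \bigcup_n
  [set s | norm1 (g n s - rat_row q) < k.+1%:R^-1].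
have mE : measurable E.
  apply: bigcap_measurable => // k _; rewrite bigcup_mkcond.
  apply: countable_bigcupT_measurable => [|q]; first exact: countableP.
  case: ifP => _; last exact: measurable0.
  by apply: bigcup_measurable => n _; exact: measurable_norm1_lt.
have -> : [set t | `[0, T]%classic t /\ castaing t `&` K !=set0] =
    `[0, T]%classic `&` ((N `&` [set t | K 0]) `|` (E `\` N)).
  apply/seteqP; split => t.
    move=> [tT [x [xt Kx]]]; split => //; move: xt; rewrite /castaing.
    case: ifPn => [|/negP]; rewrite inE => tN xt.
      by left; split => //=; rewrite -xt.
    right; split => // k _.
    have e0 : 0 < k.+1%:R^-1 :> R by rewrite invr_gt0.
    have k0 : 0 < k.+1%:R^-1 / 2 :> R by rewrite divr_gt0.
    have [n hn] := xt _ k0; have [q hq] := rat_row_dense x k0.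
    exists q.
      by exists x => //; rewrite (lt_trans hq) // ltr_pdivrMr // ltr_pMr // ltr1n.
    exists n => //=; apply: le_lt_trans (norm1_dist_triangle _ x _) _.
    by rewrite (norm1B (g n t)) [ltRHS]splitr ltrD.
  move=> [tT [[tN K0]|[Et tN]]]; split => //; rewrite /castaing.
    by rewrite mem_set //; exists 0.
  rewrite memNset //; apply: (adherent_points_meet (gH tT tN)) => // k.
  (* At this index both distances are below 1/(2k+2), so they add up to less than 1/(k+1). *)
  have [q [y Ky hy] [n _ /= hn]] := Et k.*2.+1 Logic.I.
  exists n, y => //; apply: le_lt_trans (norm1_dist_triangle _ (rat_row q) _) _.
  have kE : k.+1%:R^-1 = k.*2.+2%:R^-1 + k.*2.+2%:R^-1 :> R.
    by rewrite -doubleS -muln2 natrM invfM -splitr.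
  by rewrite kE (norm1B (rat_row q)) ltrD.
apply: measurableI => //; apply: measurableU; last exact: measurableD.
apply: measurableI => //.
have [K0|K0] := pselect (K 0).
  rewrite (_ : [set t | K 0] = setT); first exact: measurableT.
  by apply/seteqP; split => t.
rewrite (_ : [set t | K 0] = set0); first exact: measurable0.
by apply/seteqP; split => t.
Qed.

End castaing.

(** * The densities of the elements of L *)

Section densities.
Context {R : realType} {d : nat}.
Variables (T p : R) (x0 : 'rV[R]_d) (L : set (R -> 'rV[R]_d)).
Hypotheses (hT : 0 < T) (hd : (0 < d)%N) (hp : 1 <= p).
Hypothesis hL : L `<=` BVp T p.
Hypothesis hac : p = 1 -> forall f, L f -> abs_continuous T f.
Hypothesis hL0 : [set f 0 | f in L] = [set x0].
Hypothesis hbounded : BVp_bounded T p L.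
Hypothesis hdec : Vp_decomposable T L.
Hypothesis hconvex : convex_set L.
Hypothesis hclosed : supnorm_closed T p L.
Local Notation mu := (@lebesgue_measure R).
Implicit Types phi psi : R -> 'rV[R]_d.

Definition density phi : Prop :=
  [/\ mcoord phi, icoord T phi & L (primitive T x0 phi)].

Lemma L_density f : L f -> exists2 phi, density phi & f = primitive T x0 phi.
Proof.
move=> Lf; have [phi [mphi iphi h]] := BVp_density hT hp (hL Lf) (fun e => hac e Lf).
have f0 : f 0 = x0 by have : [set x0] (f 0) by rewrite -hL0; exists f.
suff fE : f = primitive T x0 phi by exists phi => //; split => //; rewrite -fE.
apply/funext => t; rewrite /primitive -f0; case: ifP => [/h //|tT].
by have [h0 _] := hL Lf; apply: h0; rewrite /= in_itv /= tT.
Qed.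

Lemma density_exists : exists phi, density phi.
Proof.
have : [set f 0 | f in L] x0 by rewrite hL0.
by move=> [f /L_density[phi ? _] _]; exists phi.
Qed.

Lemma density_bound : exists C : R, forall phi, density phi ->
  (\int[mu]_(s in `[0%R, T]) (norm1 (phi s) `^ p)%:E <= C%:E)%E.
Proof.
have [M hM] := hbounded.
have p0 : 0 < p := lt_le_trans ltr01 hp.
(* The factor d^p comes from [norm1_powR_le]; each of the d coordinates contributes at most the
   Riesz variation, itself at most M^p. *)
exists (d%:R `^ p * (d%:R * M `^ p)) => phi [mphi iphi Lphi].
set f := primitive T x0 phi in Lphi.
have [_ fV] := hL Lphi.
have V0 : (0 <= riesz_variation T p f)%E by exact: riesz_variation_ge0.
have Vfin : riesz_variation T p f \is a fin_num by rewrite ge0_fin_numE.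
set V := fine (riesz_variation T p f).
have hV : forall s, itv_partition 0 T s -> riesz_sum p f s <= V.
  by apply/riesz_variation_bound; rewrite /V fineK.
have V0' : 0 <= V by exact: fine_ge0.
have VM : V <= M `^ p.
  have : ((V `^ p^-1)%:E <= M%:E)%E.
    apply: le_trans (hM _ Lphi); rewrite /BVp_norm -[X in (_ + X `^ _)%E]fineK //.
    rewrite poweR_EFin -/V leeDr //.
    apply: (@le_trans _ _ (enorm (f 0))%:E); first by rewrite lee_fin enorm_ge0.
    by apply: ereal_sup_ubound; exists 0 => //=; rewrite in_itv /= lexx ltW.
  rewrite lee_fin => VM; rewrite -[leLHS](powRr1 V0') -(mulVf (lt0r_neq0 p0)).
  by rewrite powRrM ge0_ler_powR ?nnegrE ?powR_ge0 ?(ltW p0) // (le_trans _ VM) // powR_ge0.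
have icoordP i : (\int[mu]_(s in `[0%R, T]) (`|phi s 0 i| `^ p)%:E <= (M `^ p)%:E)%E.
  apply: (@le_trans _ _ V%:E); last by rewrite lee_fin.
  apply: (powR_density_bound hT hp (mphi i) (iphi i) (c := x0 0 i) (F := fun t => f t 0 i)).
    by move=> t tT; rewrite /f /primitive tT !mxE.
  by move=> n; exact: (sum_slope_powR hT hp hV).
have mp i : measurable_fun `[0, T]%classic (fun s => (`|phi s 0 i| `^ p)%:E).
  apply/measurable_EFinP/measurable_funTS.
  apply: (@measurableT_comp _ _ _ _ _ _ (fun x : R => x `^ p)).
    exact: measurable_powR.
  by apply: measurableT_comp => //; exact: mphi.
apply: (@le_trans _ _ (\int[mu]_(s in `[0%R, T])
    ((d%:R `^ p)%:E * (\sum_i (`|phi s 0 i| `^ p)%:E))%E)%E).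
  apply: ge0_le_integral => //.
  - by move=> s _; rewrite lee_fin powR_ge0.
  - apply/measurable_EFinP/measurable_funTS.
    apply: (@measurableT_comp _ _ _ _ _ _ (fun x : R => x `^ p)).
      exact: measurable_powR.
    exact: measurable_norm1.
  - apply: measurable_funeM; apply: emeasurable_sum => i; exact: mp.
  - by move=> s _; rewrite sumEFin -EFinM lee_fin norm1_powR_le.
rewrite ge0_integralZl_EFin ?powR_ge0 //; last 2 first.
- by move=> s _; rewrite sume_ge0 // => i _; rewrite lee_fin powR_ge0.
- by apply: emeasurable_sum => i; exact: mp.
rewrite EFinM lee_pmul2l ?lte_fin ?powR_gt0 ?ltr0n //.
rewrite ge0_integral_sum //.
apply: (@le_trans _ _ (\sum_(i < d) (M `^ p)%:E)%E); first exact: lee_sum.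
by rewrite sumEFin lee_fin sumr_const card_ord mulr_natl.
Qed.

Lemma measurable_norm1_powR phi : mcoord phi ->
  measurable_fun setT (fun s => norm1 (phi s) `^ p).
Proof.
move=> mphi; apply: (@measurableT_comp _ _ _ _ _ _ (fun x : R => x `^ p)).
  exact: measurable_powR.
exact: measurable_norm1.
Qed.

Lemma density_integrable_powR phi : density phi ->
  mu.-integrable `[0, T] (fun s => (norm1 (phi s) `^ p)%:E).
Proof.
move=> dphi; have [C hC] := density_bound; have [mphi _ _] := dphi.
apply/integrableP; split.
  by apply/measurable_EFinP/measurable_funTS; exact: measurable_norm1_powR.
under eq_integral do rewrite gee0_abs ?lee_fin ?powR_ge0 //.
by apply: (le_lt_trans (hC _ dphi)); rewrite ltry.
Qed.

Lemma density_ext phi psi : density phi -> mcoord psi ->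
  (forall s, 0 <= s <= T -> phi s = psi s) -> density psi.
Proof.
move=> [m1 i1 L1] m2 e; split => //; last by rewrite -(eq_primitive x0 e).
move=> i; apply: eq_integrable (i1 i) => // s; rewrite inE /= in_itv /= => sT.
by rewrite e.
Qed.

Lemma density_oplus phi psi a : density phi -> density psi -> 0 <= a <= T ->
  density (mix `]-oo, a[%classic phi psi).
Proof.
move=> [m1 i1 L1] [m2 i2 L2] aT.
have mA : measurable (`]-oo, a[%classic : set R) by [].
split; first exact: mcoord_mix.
- apply: icoord_norm1; first exact: mcoord_mix.
  apply: integrable_mix => //; first exact: norm1_ge0.
  + exact: measurable_norm1.
  + exact: integrable_norm1.
  + exact: integrable_norm1.
have := hdec L1 L2 aT; rewrite oplus_primitive //.
rewrite (_ : (fun s => _) = mix `]-oo, a[%classic phi psi) //.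
by apply/funext => s; rewrite /mix mem_setE in_itv.
Qed.

Lemma density_convex phi psi (c : R) : density phi -> density psi -> 0 <= c <= 1 ->
  density (fun s => c *: phi s + (1 - c) *: psi s).
Proof.
move=> [m1 i1 L1] [m2 i2 L2] c01.
split.
- by apply: mcoordD; [exact: (mcoordZ (h := cst c))|exact: (mcoordZ (h := cst (1 - c)))].
- by apply: icoordD; [exact: (icoordZ c i1)|exact: (icoordZ (1 - c) i2)].
have /andP[c0 c1] := c01.
have := set_mem (hconvex (Itv01 c0 c1) (mem_set L1) (mem_set L2)).
rewrite (_ : primitive T x0 (fun s => c *: phi s + (1 - c) *: psi s) =
  c *: primitive T x0 phi + (1 - c) *: primitive T x0 psi) //.
apply/funext => t; rewrite !fctE /primitive.
case: ifP => [/andP[t0 tT]|_]; last by rewrite !scaler0 addr0.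
have sub : `[0, t]%classic `<=` `[0, T]%classic.
  by move=> s; rewrite /= !in_itv /= => /andP[-> /le_trans]; apply.
have i1t i : mu.-integrable `[0, t] (fun s => (phi s 0 i)%:E) by apply: integrableS (i1 i).
have i2t i : mu.-integrable `[0, t] (fun s => (psi s 0 i)%:E) by apply: integrableS (i2 i).
apply/rowP => i; rewrite !mxE.
have -> : \int[mu]_(s in `[0, t]) ((c *: phi s + (1 - c) *: psi s) 0 i) =
    \int[mu]_(s in `[0, t]) (c * phi s 0 i + (1 - c) * psi s 0 i).
  by apply: eq_Rintegral => s _; rewrite !mxE.
rewrite RintegralD ?RintegralZl //; last 2 first.
- by apply: integrable_realZ.
- by apply: integrable_realZ.
- by ring.
- exact: i2t.
- exact: i1t.
Qed.

(** L^1 approximation of phi gives sup-norm approximation of its primitive; p-integrability puts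
    that primitive in BV_p, where L is closed. *)
Lemma density_closed phi : mcoord phi -> icoord T phi ->
  mu.-integrable `[0, T] (fun s => (norm1 (phi s) `^ p)%:E) ->
  (forall e : R, 0 < e -> exists2 psi, density psi &
    \int[mu]_(s in `[0, T]) norm1 (phi s - psi s) < e) ->
  density phi.
Proof.
move=> mphi iphi ip h; split => //; apply: hclosed.
  exact: primitive_BVp.
move=> e e0; have [psi [m2 i2 L2] hpsi] := h e e0.
exists (primitive T x0 psi) => //.
apply: (@le_lt_trans _ _ (\int[mu]_(s in `[0, T]) norm1 (phi s - psi s))%:E); last by rewrite lte_fin.
apply: ge_ereal_sup => _ [t tT <-]; rewrite /= in_itv /= in tT; rewrite lee_fin.
apply: le_trans (enorm_le_norm1 _) _.
rewrite /primitive /= tT opprD addrACA subrr add0r.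
exact: norm1_vintegralB.
Qed.

Lemma density_cvg phi (psi : nat -> R -> 'rV[R]_d) (g : R -> R) : mcoord phi ->
  mu.-integrable `[0, T] (fun s => (norm1 (phi s) `^ p)%:E) ->
  icoord T phi ->
  (forall n, density (psi n)) ->
  {ae mu, forall s, `[0, T]%classic s -> norm1 (phi s - psi n s) @[n --> \oo] --> (0 : R)} ->
  mu.-integrable `[0, T] (fun s => (g s)%:E) ->
  (forall n s, `[0, T]%classic s -> norm1 (phi s - psi n s) <= g s) ->
  density phi.
Proof.
move=> mphi ip iphi dpsi cv ig bd.
have mpsi n : mcoord (psi n) by have [] := dpsi n.
apply: density_closed => // e e0.
have mn n : measurable_fun `[0, T]%classic (fun s => (norm1 (phi s - psi n s))%:E).
  apply/measurable_EFinP/measurable_funTS.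
  exact: (measurable_norm1 (mcoordB mphi (mpsi n))).
have cv' : {ae mu, forall s, `[0, T]%classic s ->
    (norm1 (phi s - psi n s))%:E @[n --> \oo] --> (cst 0%E s : \bar R)}.
  apply: filterS cv => s h /h {}h.
  by apply/fine_cvgP; split; [exact: nearW|].
have bd' : {ae mu, forall s n, `[0, T]%classic s ->
    (`|(norm1 (phi s - psi n s))%:E| <= (g s)%:E)%E}.
  apply: aeW => s n sT; rewrite gee0_abs ?lee_fin ?norm1_ge0 //; exact: bd.
have [_ _] := @dominated_convergence _ _ _ mu _ (measurable_itv `[0, T])
  (fun n s => (norm1 (phi s - psi n s))%:E) (cst 0%E) (fun s => (g s)%:E)
  mn (measurable_cst _) cv' ig bd'.
rewrite integral0 => /fine_cvgP[_ /cvgrPdist_lt /(_ e e0)[N _ hN]].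
exists (psi N) => //; have := hN N (leqnn N).
rewrite /= sub0r normrN; apply: le_lt_trans; exact: ler_norm.
Qed.

(** * Gluing along Borel sets *)

Definition decomposable_set (A : set R) : Prop := measurable A /\
  forall phi psi, density phi -> density psi -> density (mix A phi psi).

Lemma mixC A phi psi : mix (~` A) phi psi = mix A psi phi.
Proof. by apply/funext => s; rewrite /mix in_setC; case: (s \in A). Qed.

Lemma mixU A B phi psi : mix (A `|` B) phi psi = mix A phi (mix B phi psi).
Proof. by apply/funext => s; rewrite /mix in_setU; case: (s \in A). Qed.

Lemma decomposable_setU A B : decomposable_set A -> decomposable_set B ->
  decomposable_set (A `|` B).
Proof.
move=> [mA hA] [mB hB]; split; first exact: measurableU.
by move=> phi psi d1 d2; rewrite mixU; apply: hA => //; exact: hB.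
Qed.

Lemma decomposable_set0 : decomposable_set set0.
Proof.
split => // phi psi d1 d2; rewrite (_ : mix _ _ _ = psi) //.
by apply/funext => s; rewrite /mix in_set0.
Qed.

Lemma integrable_norm1_density phi : density phi ->
  mu.-integrable `[0, T] (fun s => (norm1 (phi s))%:E).
Proof. by move=> [_ i1 _]; exact: integrable_norm1. Qed.

(** At each point the gluings along finite unions are eventually equal to the gluing along the whole
    union, and |phi| + |psi| dominates the differences. *)
Lemma decomposable_bigcup (F : nat -> set R) : (forall n, decomposable_set (F n)) ->
  decomposable_set (\bigcup_n F n).
Proof.
move=> hF.
have hU n : decomposable_set (\big[setU/set0]_(i < n) F i).
  by elim/big_ind : _ => //; [exact: decomposable_set0|exact: decomposable_setU].
have mF : measurable (\bigcup_n F n) by apply: bigcup_measurable => n _; have [] := hF n.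
split => // phi psi d1 d2.
have [m1 i1 _] := d1; have [m2 i2 _] := d2.
have mm : mcoord (mix (\bigcup_n F n) phi psi) by exact: mcoord_mix.
apply: (@density_cvg _ (fun n => mix (\big[setU/set0]_(i < n) F i) phi psi)
    (fun s => norm1 (phi s) + norm1 (psi s))) => //.
- apply: (integrable_mix (K := fun x => norm1 x `^ p)) => //.
  + by move=> x; exact: powR_ge0.
  + exact: measurable_norm1_powR.
  + exact: density_integrable_powR.
  + exact: density_integrable_powR.
- apply: icoord_norm1 => //; apply: integrable_mix => //; first exact: norm1_ge0.
  + exact: measurable_norm1.
  + exact: integrable_norm1_density.
  + exact: integrable_norm1_density.
- by move=> n; have [_] := hU n; apply.
- apply: aeW => s _; rewrite /mix.
  have [[k _ Fk]|nF] := pselect ((\bigcup_n F n) s).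
    apply: cvg_near_cst; exists k.+1 => // n /= kn.
    rewrite !mem_set ?subrr ?norm1_0 //; last by exists k.
    by rewrite -bigcup_mkord; exists k.
  apply: cvg_near_cst; apply: nearW => n.
  rewrite !memNset ?subrr ?norm1_0 //.
  by rewrite -bigcup_mkord => -[k _ Fk]; apply: nF; exists k.
- by apply: integrable_realD => //; exact: integrable_norm1_density.
- move=> n s _; rewrite /mix; case: ifP => _; case: ifP => _;
    rewrite ?subrr ?norm1_0 ?addr_ge0 ?norm1_ge0 //.
    by rewrite (le_trans (norm1_triangle _ _)) // norm1N.
  by rewrite (le_trans (norm1_triangle _ _)) // norm1N addrC.
Qed.

Lemma decomposable_ray (a : R) : decomposable_set `]-oo, a[%classic.
Proof.
split=> // phi psi d1 d2.
have [m1 _ _] := d1; have [m2 _ _] := d2.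
have mm : mcoord (mix `]-oo, a[%classic phi psi) by exact: mcoord_mix.
(* When a is outside [0, T] the ray contains none or all of [0, T]. *)
have [a0|a0] := ltP a 0.
  apply: density_ext d2 mm _ => s /andP[s0 sT].
  rewrite /mix memNset //= in_itv /= => /ltW sa.
  by have := le_lt_trans s0 (le_lt_trans sa a0); rewrite ltxx.
have [aT|aT] := leP a T; first by apply: density_oplus => //; rewrite a0.
apply: density_ext d1 mm _ => s /andP[s0 sT].
by rewrite /mix mem_set //= in_itv /= (le_lt_trans sT).
Qed.

(** The sets that allow gluing form a sigma-algebra, complementation merely swapping the two
    densities, and the rays generate the Borel sets. *)
Lemma decomposable_measurable (A : set R) : measurable A -> decomposable_set A.
Proof.
move=> mA; have : (@ocitv R).-sigma.-measurable A := mA.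
rewrite RGenInftyO.measurableE; move: A {mA}; apply: smallest_sub.
  split=> [|B [mB hB]|F hF].
  - exact: decomposable_set0.
  - rewrite setTD; split; first exact: measurableC.
    by move=> phi psi d1 d2; rewrite mixC; exact: hB.
  - exact: decomposable_bigcup.
by move=> _ [x ->]; exact: decomposable_ray.
Qed.

Let dmix A phi psi : measurable A -> density phi -> density psi ->
  density (mix A phi psi).
Proof.
move=> mA; have [_] := decomposable_measurable mA.
exact.
Qed.

(* chi n picks at each point, among g 0, ..., g n, a value of least cost c. *)
Lemma greedy_selection (g : nat -> R -> 'rV[R]_d) (c : R -> 'rV[R]_d -> R) :
  (forall n, density (g n)) ->
  (forall chi, mcoord chi -> measurable_fun setT (fun s => c s (chi s))) ->
  exists chi : nat -> R -> 'rV[R]_d, [/\ forall n, density (chi n),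
    forall n k s, (k <= n)%N -> c s (chi n s) <= c s (g k s) &
    forall n s, c s (chi n.+1 s) <= c s (chi n s)].
Proof.
move=> dg mc.
pose step n (chi : R -> 'rV[R]_d) :=
  mix [set s | c s (g n.+1 s) < c s (chi s)] (g n.+1) chi.
pose chi := fix chi n := if n is m.+1 then step m (chi m) else g 0%N.
have dec n s : c s (chi n.+1 s) <= c s (chi n s).
  rewrite /= /step /mix; case: ifPn => // /set_mem /=; exact: ltW.
have le1 n s : c s (chi n.+1 s) <= c s (g n.+1 s).
  rewrite /= /step /mix; case: ifPn => // /negP h.
  by rewrite leNgt; apply/negP => h'; apply: h; rewrite inE.
exists chi; split => //.
- elim=> [|n IH]; first exact: dg.
  have [m1 _ _] := IH; have [m2 _ _] := dg n.+1.
  by apply: dmix => //; apply: measurable_lt_set; exact: mc.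
- elim=> [|n IH] k s; first by rewrite leqn0 => /eqP ->.
  rewrite leq_eqVlt => /predU1P[->|]; first exact: le1.
  by rewrite ltnS => /(IH k s); apply: le_trans.
Qed.

(** Truncation makes the cost integrable on [0, T] for every measurable function, without altering
    small distances. *)
Let cost (q x : 'rV[R]_d) : R := Num.min 1 (norm1 (x - q)).

Let cost_ge0 q x : 0 <= cost q x.
Proof. by rewrite le_min ler01 norm1_ge0. Qed.

Let measurable_cost q chi : mcoord chi -> measurable_fun setT (fun s => cost q (chi s)).
Proof.
move=> mchi; apply: measurable_minr => //.
apply: (measurable_norm1 (phi := fun s => chi s - q)).
exact: (mcoordB mchi (psi := cst q)).
Qed.

Let integrable_cost q chi : mcoord chi ->
  mu.-integrable `[0, T] (fun s => (cost q (chi s))%:E).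
Proof.
move=> mchi; apply: (integrable_real_le _ _ _ (integrable_cst_itv _ _ 0 T 1)) => //.
  exact: measurable_funTS (measurable_cost q mchi).
by move=> s _; rewrite ger0_norm // /cost ge_min lexx.
Qed.

(** Let B k be where phi beats every f n by at least 1/(k+1). Inserting phi into f n wherever it is
    cheaper gives a density whose integral is smaller by at least mu(B k)/(k+1). Since f n is within
    1/(n+1) of the infimum for every n, B k is null. *)
Lemma minimizing_sequence q : exists f : nat -> R -> 'rV[R]_d,
  (forall n, density (f n)) /\
  forall phi, density phi -> {ae mu, forall s, `[0, T]%classic s ->
    forall e : R, 0 < e -> exists n, cost q (f n s) < cost q (phi s) + e}.
Proof.
pose I phi := \int[mu]_(s in `[0, T]) cost q (phi s).
pose S := [set I phi | phi in density].
have I0 phi : 0 <= I phi by apply: Rintegral_ge0.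
have [phi0 dphi0] := density_exists.
have hS : has_inf S.
  by split; [exists (I phi0), phi0|exists 0 => _ [phi _ <-]].
have /choice[f hf] : forall n : nat, exists f, density f /\ I f < inf S + n.+1%:R^-1.
  move=> n; have n0 : 0 < n.+1%:R^-1 :> R by rewrite invr_gt0.
  by have [_ [f df <-] h] := inf_adherent n0 hS; exists f.
exists f; split=> [n|phi dphi]; first by have [] := hf n.
have [mphi _ _] := dphi.
have mf n : mcoord (f n) by have [[]] := hf n.
pose B (k : nat) := [set s | `[0, T]%classic s /\ forall n, cost q (phi s) + k.+1%:R^-1 <= cost q (f n s)].
have mB k : measurable (B k).
  rewrite (_ : B k = `[0, T]%classic `&` \bigcap_n (~` [set s | cost q (f n s) < cost q (phi s) + k.+1%:R^-1])).
    apply: measurableI => //; apply: bigcap_measurable => // n _.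
    apply: measurableC; apply: measurable_lt_set; first exact: measurable_cost.
    by apply: measurable_funD => //; exact: measurable_cost.
  apply/seteqP; split => s /= [sT h]; split => // n.
    by move=> _ /=; rewrite ltNge; apply/negP/negPn/h.
  by have /= := h n Logic.I; rewrite ltNge => /negP/negPn.
have B0 k : mu (B k) = 0%E.
  have k0 : 0 < k.+1%:R^-1 :> R by rewrite invr_gt0.
  have bound n : ((k.+1%:R^-1)%:E * mu (B k) <= (n.+1%:R^-1)%:E)%E.
    have [df hn] := hf n.
    pose A := [set s | cost q (phi s) < cost q (f n s)].
    have mA : measurable A by apply: measurable_lt_set; exact: measurable_cost.
    pose h := mix A phi (f n).
    have dh : density h by exact: dmix.
    have [mh _ _] := dh.
    have hh : inf S <= I h by apply: (ge_inf hS.2); exists h.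
    have hle s : cost q (h s) <= cost q (f n s).
      by rewrite /h /mix; case: ifPn => // /set_mem /ltW.
    have iD : mu.-integrable `[0, T] (fun s => (cost q (f n s) - cost q (h s))%:E).
      by apply: integrable_realB => //; exact: integrable_cost.
    have D1 : \int[mu]_(s in `[0, T]) (cost q (f n s) - cost q (h s)) <= n.+1%:R^-1.
      rewrite RintegralB //; last 2 first.
      - exact: integrable_cost.
      - exact: integrable_cost.
      have : I (f n) - I h <= n.+1%:R^-1.
        by rewrite lerBlDl (le_trans (ltW hn)) // lerD2r.
      by [].
    apply: le_trans (_ : (_ <= (\int[mu]_(s in `[0, T]) (cost q (f n s) - cost q (h s)))%:E)%E) _; last by rewrite lee_fin.
    have D0 s : (0 <= (cost q (f n s) - cost q (h s))%:E)%E by rewrite lee_fin subr_ge0.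
    rewrite /Rintegral fineK; last exact: integrable_fin_num.
    rewrite -integral_cst //.
    have mD (E : set R) : measurable_fun E (fun s => (cost q (f n s) - cost q (h s))%:E).
      by apply/measurable_EFinP/measurable_funTS/measurable_funB; exact: measurable_cost.
    apply: (@le_trans _ _ (\int[mu]_(s in B k) (cost q (f n s) - cost q (h s))%:E)%E).
      apply: ge0_le_integral => //.
      - exact: mB.
      - by move=> s _; rewrite /= lee_fin ltW.
      - exact: mD.
      - move=> s [_ /(_ n) hs]; rewrite lee_fin /h /mix mem_set; first by rewrite lerBrDl.
        by rewrite /A /= (lt_le_trans _ hs) // ltrDl.
    by apply: ge0_subset_integral => //; [exact: mB|exact: mD|move=> s []].
    exact: mB.
  apply/eqP; rewrite eq_le measure_ge0 andbT; apply/lee_addgt0Pr => e e0.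
  rewrite add0e.
  pose n := Num.truncn (k.+1%:R / e).
  have hn : n.+1%:R^-1 <= k.+1%:R^-1 * e.
    rewrite -[leRHS]invrK lef_pV2 ?posrE ?invr_gt0 ?mulr_gt0 //.
    by rewrite invfM invrK ltW // truncnS_gt.
  have := le_trans (bound n) (_ : _ <= (k.+1%:R^-1 * e)%:E)%E.
  rewrite lee_fin => /(_ hn).
  by rewrite EFinM lee_pmul2l // lte_fin.
have : {ae mu, forall s, forall k, ~ B k s}.
  apply: ae_foralln => k; exists (B k); split; [exact: mB|exact: B0|].
  by move=> s /= /contrapT.
apply: filterS => s h sT e e0.
apply: contrapT => /forallNP he.
apply: (h (Num.truncn e^-1)); split => // n.
have := he n => /negP; rewrite -leNgt; apply: le_trans.
rewrite lerD2l -[leRHS]invrK lef_pV2 ?posrE ?invr_gt0 //.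
by rewrite ltW // truncnS_gt.
Qed.

Lemma countable_dense_densities : exists g : nat -> R -> 'rV[R]_d,
  (forall n, density (g n)) /\
  forall phi, density phi -> {ae mu, forall s, `[0, T]%classic s ->
    forall e : R, 0 < e -> exists n, norm1 (phi s - g n s) < e}.
Proof.
have /choice[F hF] : forall q : 'rV[rat]_d, exists f : nat -> R -> 'rV[R]_d,
  (forall n, density (f n)) /\
  forall phi, density phi -> {ae mu, forall s, `[0, T]%classic s ->
    forall e : R, 0 < e -> exists n, cost (rat_row q) (f n s) < cost (rat_row q) (phi s) + e}.
  by move=> q; exact: minimizing_sequence.
(* The default makes g n a density also when n encodes no pair. *)
pose g n := if @unpickle ('rV[rat]_d * nat)%type n is Some qm then F qm.1 qm.2 else F 0 0%N.
exists g; split => [n|phi dphi].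
  rewrite /g; case: unpickle => [[q m]|] /=; first by have [] := hF q.
  by have [] := hF 0.
have : {ae mu, forall s, forall q : 'rV[rat]_d, `[0, T]%classic s ->
    forall e : R, 0 < e -> exists n, cost (rat_row q) (F q n s) < cost (rat_row q) (phi s) + e}.
  by apply: ae_forall_count => q; have [_] := hF q; apply.
apply: filterS => s h sT e e0.
(* With this choice 2e' < 1, so a cost below 2e' is an untruncated distance; adding the distance e'
   from q to phi s gives less than 3e' <= e. *)
pose e' := Num.min 1 e / 3.
have m0 : 0 < Num.min 1 e by rewrite lt_min ltr01.
have e'0 : 0 < e' by rewrite divr_gt0.
have [q hq] := rat_row_dense (phi s) e'0.
have [n hn] := h q sT e' e'0.
exists (pickle (q, n)); rewrite /g pickleK /=.
have m1 : Num.min 1 e <= 1 by rewrite ge_min lexx.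
have me : Num.min 1 e <= e by rewrite ge_min lexx orbT.
have e'E : Num.min 1 e = 3 * e' by rewrite /e'; field.
have c1 : cost (rat_row q) (phi s) <= norm1 (phi s - rat_row q) by rewrite ge_min lexx orbT.
have c2 : norm1 (F q n s - rat_row q) < 2 * e'.
  have : cost (rat_row q) (F q n s) < 2 * e' by lra.
  rewrite gt_min => /orP[|//]; lra.
apply: le_lt_trans (norm1_dist_triangle _ (rat_row q) _) _.
by rewrite (norm1B (rat_row q)); lra.
Qed.

(** With cost - [norm1], the greedy densities realize the largest norm among g 0, ..., g n.
    [density_bound] applies to them uniformly in n, and monotone convergence carries it to the
    supremum W of the p-th powers. *)
Lemma dominating_function (g : nat -> R -> 'rV[R]_d) : (forall n, density (g n)) ->
  exists2 H : R -> R, Lp_scalar T p H &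
    {ae mu, forall s, `[0, T]%classic s -> forall n, norm1 (g n s) <= H s}.
Proof.
move=> dg; have p0 : 0 < p := lt_le_trans ltr01 hp.
have mc (chi : R -> 'rV[R]_d) : mcoord chi ->
    measurable_fun setT (fun s => - norm1 (chi s)).
  by move=> mchi; apply: measurableT_comp => //; exact: measurable_norm1.
have [chi [dchi hchi dec]] :=
  greedy_selection (c := fun _ x => - norm1 x) dg mc.
have [C hC] := density_bound.
pose a n s := (norm1 (chi n s) `^ p)%:E.
have ma n : measurable_fun setT (a n).
  by apply/measurable_EFinP; apply: measurable_norm1_powR; have [] := dchi n.
have a0 n s : (0 <= a n s)%E by rewrite lee_fin powR_ge0.
have nda s : nondecreasing_seq (a ^~ s).
  apply/nondecreasing_seqP => n; rewrite lee_fin ge0_ler_powR ?nnegrE ?norm1_ge0 ?(ltW p0) //.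
  by have := dec n s; rewrite lerN2.
have cva s : cvgn (a ^~ s) by exact: ereal_nondecreasing_is_cvgn.
pose W s := ereal_sup (range (a ^~ s)).
have cvW s : a ^~ s @ \oo --> W s by exact: ereal_nondecreasing_cvgn.
have aW n s : (a n s <= W s)%E by apply: ereal_sup_ubound; exists n.
have W0 s : (0 <= W s)%E by exact: le_trans (a0 0%N s) (aW 0%N s).
have mW : measurable_fun setT W.
  by apply: (emeasurable_fun_cvg a) => // s _; exact: cvW.
have maT n : measurable_fun `[0, T]%classic (a n) by exact: measurable_funTS.
have mWT : measurable_fun `[0, T]%classic W by exact: measurable_funTS.
have intW : (\int[mu]_(s in `[0%R, T]) W s <= C%:E)%E.
  have -> : (\int[mu]_(s in `[0%R, T]) W s =
      \int[mu]_(s in `[0%R, T]) limn (a ^~ s))%E.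
    by apply: eq_integral => s _; apply/esym/cvg_lim.
  rewrite monotone_convergence //.
  apply: lime_le.
    apply: ereal_nondecreasing_is_cvgn => m n mn.
    apply: ge0_le_integral; [by []|by []|exact: maT|exact: maT|].
    by move=> s _; exact: nda.
  by apply: nearW => n; exact: hC.
have iW : mu.-integrable `[0, T] W.
  apply/integrableP; split => //.
  under eq_integral do rewrite gee0_abs //.
  by rewrite (le_lt_trans intW) // ltry.
(* [fine] sends an infinite value to 0; this happens on a null subset of [0, T] only, and
   [fine (W s)] never exceeds [W s]. *)
exists (fun s => fine (W s) `^ p^-1).
  split.
    apply: measurable_funTS.
    apply: (@measurableT_comp _ _ _ _ _ _ (fun x : R => x `^ p^-1)).
      exact: measurable_powR.
    by apply: measurableT_comp.
  apply: (@le_lt_trans _ _ (\int[mu]_(s in `[0%R, T]) W s)%E); last first.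
    by rewrite (le_lt_trans intW) // ltry.
  have E s : (`|fine (W s) `^ p^-1| `^ p)%:E = (fine (W s))%:E.
    rewrite ger0_norm ?powR_ge0 // -powRrM mulVf ?gt_eqF // powRr1 //.
    exact: fine_ge0.
  under eq_integral do rewrite E.
  apply: ge0_le_integral => //.
  - by move=> s _; rewrite lee_fin fine_ge0.
  - by apply/measurable_EFinP; apply: measurable_funTS; exact: measurableT_comp.
  - move=> s _; have := W0 s; case: (W s) => [r| |] //= _; exact: leey.
have finW : {ae mu, forall s, `[0, T]%classic s -> W s \is a fin_num}.
  by apply: integrable_ae.
apply: filterS finW => s fW sT n.
apply: (@le_trans _ _ (norm1 (chi n s))).
  by have := hchi n n s (leqnn n); rewrite lerN2.
rewrite -[leLHS](powRr1 (norm1_ge0 _)) -(mulfV (lt0r_neq0 p0)) powRrM.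
rewrite ge0_ler_powR ?nnegrE ?powR_ge0 ?invr_ge0 ?(ltW p0) ?fine_ge0 //.
by rewrite -lee_fin fineK; [exact: aW|exact: fW].
Qed.

Lemma measurable_enorm_powR (phi : R -> 'rV[R]_d) : mcoord phi ->
  measurable_fun setT (fun s => enorm (phi s) `^ p).
Proof.
move=> mphi; apply: (@measurableT_comp _ _ _ _ _ _ (fun x : R => x `^ p)).
  exact: measurable_powR.
apply: (@measurableT_comp _ _ _ _ _ _ (@Num.sqrt R)).
  by apply: continuous_measurable_fun; exact: sqrt_continuous.
by apply: measurable_sum => i; apply: measurable_funX; exact: mphi.
Qed.

Lemma decomposable_is_integral : is_integral T p L.
Proof.
have p0 : 0 < p := lt_le_trans ltr01 hp.
have [g [dg dense]] := countable_dense_densities.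
have mg n : mcoord (g n) by have [] := dg n.
have [H HLp gH] := dominating_function dg.
have gconv : {ae mu, forall s, forall nmq : nat * nat * rat, `[0, T]%classic s ->
    0 <= (ratr nmq.2 : R) <= 1 -> adherent_points (g ^~ s)
      (ratr nmq.2 *: g nmq.1.1 s + (1 - ratr nmq.2) *: g nmq.1.2 s)}.
  apply: ae_forall_count => -[[n m] q] /=.
  have [q01|nq] := boolP (0 <= (ratr q : R) <= 1); last first.
    by apply: aeW.
  have := dense _ (density_convex (dg n) (dg m) q01).
  by apply: filterS => s h sT _; exact: h.
(* One measurable null set N carries all the exceptions; [castaing] is defined with it. *)
have [N [mN N0 hN]] : {ae mu, forall s, `[0, T]%classic s ->
    (forall n, norm1 (g n s) <= H s) /\
    (forall n m (q : rat), 0 <= (ratr q : R) <= 1 ->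
    adherent_points (g ^~ s) (ratr q *: g n s + (1 - ratr q) *: g m s))}.
  apply: filterS2 gH gconv => s h1 h2 sT; split; first exact: h1.
  by move=> n m q; exact: (h2 (n, m, q)).
have hN' s : `[0, T]%classic s -> ~ N s -> (forall n, norm1 (g n s) <= H s) /\
    (forall n m (q : rat), 0 <= (ratr q : R) <= 1 ->
    adherent_points (g ^~ s) (ratr q *: g n s + (1 - ratr q) *: g m s)).
  by move=> sT nN; apply: contrapT => h; apply: nN; apply: hN => /= /(_ sT).
have gH' s sT nN := (hN' s sT nN).1.
have gc' s sT nN := (hN' s sT nN).2.
have aeN (P : R -> Prop) : (forall s, ~ N s -> P s) -> {ae mu, forall s, P s}.
  by move=> h; exists N; split => // s /= nP; apply: contrapT => /h.
exists x0, (castaing g N); split.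
- exact: castaing_Conv gH' gc'.
- exact: castaing_measurable mN mg gH'.
- exists H => //; apply: aeN => s nN sT.
  apply: ge_ereal_sup => _ [x + <-]; rewrite /castaing memNset // => gx.
  rewrite lee_fin (le_trans (enorm_le_norm1 x)) //.
  exact: (adherent_points_norm1_le (gH' s sT nN) gx).
apply/seteqP; split => [f Lf|f [fBV [phi [[mphi iphi] sel] fE]]].
  split; first exact: hL.
  have [phi dphi fE] := L_density Lf.
  have [mphi _ _] := dphi; have [C hC] := density_bound.
  exists phi; last first.
    by move=> t; rewrite /= in_itv /= => tT; rewrite fE /primitive tT.
  split; first split.
  + by move=> i; apply: measurable_funTS; exact: mphi.
  + apply: le_lt_trans (_ : (_ <= C%:E)%E) _; last by rewrite ltry.
    apply: le_trans (hC _ dphi); apply: ge0_le_integral => //.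
    * by move=> s _; rewrite lee_fin powR_ge0.
    * by apply/measurable_EFinP/measurable_funTS; exact: measurable_enorm_powR.
    * by apply/measurable_EFinP/measurable_funTS; exact: measurable_norm1_powR.
    * by move=> s _; rewrite lee_fin ge0_ler_powR ?nnegrE ?enorm_ge0 ?norm1_ge0 ?enorm_le_norm1 ?(ltW p0).
  have : {ae mu, forall s, ~ N s}.
    by apply: aeN.
  apply: filterS2 (dense _ dphi) => s h nN sT.
  by rewrite /castaing memNset //; exact: h.
(* A selection is measurable on [0, T] only; extending it by 0 makes it measurable on the line. *)
pose phi' s := if s \in `[0, T]%classic then phi s else 0.
have pE s : 0 <= s <= T -> phi' s = phi s.
  by move=> sT; rewrite /phi' mem_set //= in_itv.
have mphi' : mcoord phi'.
  move=> i; have := (measurable_restrictT (fun s => phi s 0 i) (measurable_itv `[0, T])).1 (mphi i).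
  rewrite (_ : _ \_ _ = fun s => phi' s 0 i) //; apply/funext => s.
  by rewrite patchE /phi'; case: ifP => // _; rewrite mxE.
have ip : mu.-integrable `[0, T] (fun s => (norm1 (phi' s) `^ p)%:E).
  have ie : mu.-integrable `[0, T] (fun s => (enorm (phi' s) `^ p)%:E).
    apply/integrableP; split.
      by apply/measurable_EFinP/measurable_funTS; exact: measurable_enorm_powR.
    apply: le_lt_trans iphi; rewrite le_eqVlt; apply/orP; left; apply/eqP.
    apply: eq_integral => s; rewrite inE /= in_itv /= => sT.
    by rewrite /= ger0_norm ?powR_ge0 // pE.
  have ide : mu.-integrable `[0, T] (fun s => (d%:R `^ p * enorm (phi' s) `^ p)%:E).
    by apply: integrable_realZ.
  apply: (integrable_real_le _ _ _ ide) => //.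
    by apply: measurable_funTS; exact: measurable_norm1_powR.
  move=> s _; rewrite ger0_norm ?powR_ge0 // -powRM ?enorm_ge0 //.
  by rewrite ge0_ler_powR ?nnegrE ?mulr_ge0 ?norm1_ge0 ?enorm_ge0 ?norm1_le_enorm ?(ltW p0).
have i1 : mu.-integrable `[0, T] (fun s => (norm1 (phi' s))%:E).
  have i2 : mu.-integrable `[0, T] (fun s => (norm1 (phi' s) `^ p + 1)%:E).
    by apply: integrable_realD => //; exact: (integrable_cst_itv _ _ 0 T 1).
  apply: (integrable_real_le _ _ _ i2) => //.
    by apply: measurable_funTS; exact: measurable_norm1.
  move=> s _; rewrite ger0_norm ?norm1_ge0 //.
  (* With m = 1 this reads x <= x^p + 1, hence L^p is contained in L^1 on [0, T]. *)
  have := mulr_powRB1_le hp (norm1_ge0 (phi' s)) ler01.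
  by rewrite powR1 mulr1.
suff [_ _ Lphi] : density phi'.
  rewrite (_ : f = primitive T x0 phi') //; apply/funext => t.
  rewrite (eq_primitive x0 pE) /primitive; case: ifP => tT.
    by rewrite fE //= in_itv.
  by have [h _] := fBV; apply: h; rewrite /= in_itv /= tT.
have mc chi : mcoord chi -> measurable_fun setT (fun s => norm1 (phi' s - chi s)).
  by move=> mchi; exact: (measurable_norm1 (mcoordB mphi' mchi)).
have [chi [dchi hchi dec]] :=
  greedy_selection (c := fun s x => norm1 (phi' s - x)) dg mc.
(* The greedy choice is never farther from [phi'] than g 0 is, which provides the integrable
   bound. *)
apply: (density_cvg (psi := chi)
    (g := fun s => norm1 (phi' s) + norm1 (g 0%N s)) mphi' ip) => //.
- exact: icoord_norm1.
- have aeNN : {ae mu, forall s, ~ N s} by exact: aeN.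
  apply: filterS2 sel aeNN => s h nN sT.
  apply/cvgrPdist_lt => e e0; have := h sT; rewrite /castaing memNset // => /(_ e e0)[n hn].
  exists n => // m /= nm; rewrite sub0r normrN ger0_norm ?norm1_ge0 //.
  apply: le_lt_trans (hchi m n s nm) _.
  by rewrite pE //; move: sT; rewrite /= in_itv.
- apply: integrable_realD => //; exact: (integrable_norm1_density (dg 0%N)).
- move=> n s _; apply: le_trans (hchi n 0%N s (leq0n n)) _.
  by rewrite (le_trans (norm1_triangle _ _)) // norm1N.
Qed.

End densities.

Theorem theorem2 (R : realType) (d : nat) (T p : R) (x0 : 'rV[R]_d)
    (L : set (R -> 'rV[R]_d))
    (hT : 0 < T) (hd : (0 < d)%N) (hp : 1 <= p)
    (hL : L `<=` BVp T p)
    (* for p = 1 the conclusion fails without this; for p > 1 it is void *)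
    (hac : p = 1 -> forall f, L f -> abs_continuous T f)
    (hL0 : [set f 0 | f in L] = [set x0])
    (hbounded : BVp_bounded T p L)
    (hdec : Vp_decomposable T L)
    (hconvex : convex_set L)
    (hclosed : supnorm_closed T p L) :
  is_integral T p L.
Proof.
exact: (decomposable_is_integral hT hd hp hL hac hL0 hbounded hdec hconvex hclosed).
Qed.
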